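(* Let $\underline{s}$ be an ultimately periodic right boundary whose periodic part has height $k$, and suppose that $\underline{s}$ satisfies the slope condition for $(a,b)$-paths. Then the ordinary generating function $$\sum_{n=0}^{\infty} \mathrm{SP}_n(a,b,\sigma;\underline{s})\, z^n$$ is algebraic. In addition, if the initial segment of $\underline{s}$ has length $r$, then the section generating functions $$\sum_{q=r}^{\infty} \mathrm{SP}_{qk+j+r}(a,b,\sigma;\underline{s})\, z^q,\qquad j=0,1,2,\ldots,k-1,$$ are algebraic. (Here $\sigma$ is a variable, and algebraic means algebraic over the field of rational functions in $z$ and $\sigma$.)
   Context: A (right) boundary is a non-decreasing infinite sequence $\underline{s}=(s_0,s_1,\ldots)$ of positive integers. It is periodic of height $k$ and width $l$ ($k\ge1$) if $s_{k-1}=l$ and for all $m\ge0$, $s_m=s_r+ql$ where $q=\lfloor m/k\rfloor$, $r=m-qk$. A boundary is ultimately periodic if it is the concatenation $\underline{s}',\,p+\underline{s}''$, where $\underline{s}'$ is a finite initial sequence (the initial segment) whose last term is $p$, $\underline{s}''$ is a periodic boundary, and $p+\underline{s}''$ is obtained by adding $p$ to each term of $\underline{s}''$. Let $a,b$ be non-negative integers. An $(a,b)$-path is a finite sequence of steps, starting at the origin, each of one of three kinds: north $N$ (adding $(0,1)$), east $E$ (adding $(1,0)$), and diagonal $D$ (adding $(a,b)$); $D$ is regarded as a different kind of step from $N$ and $E$ even when $(a,b)=(0,1)$ or $(1,0)$, and it is a null step when $a=b=0$. The path is also regarded as a union of line segments, each step contributing the straight segment from its start point to its end point. $\mathrm{Right}_i(\pi)$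 is the $x$-coordinate of the rightmost point of the intersection of $\pi$ (as a union of segments) with the horizontal line $y=i$. An $(a,b)$-path ending at height $n$ is an $(a,b;\underline{s})$-path if $\mathrm{Right}_i(\pi)<s_i$ for $0\le i\le n-1$. Let $\mathrm{Path}_{n,d}(\underline{s})$ be the set of $(a,b;\underline{s})$-paths ending at $(s_n-1,n)$ and having exactly $d$ diagonal steps, and let $$\mathrm{SP}_n(a,b,\sigma;\underline{s})=\sum_{d\ge0}|\mathrm{Path}_{n,d}(\underline{s})|\,\sigma^d .$$ If $b>0$ only terms with $d\le\lfloor n/b\rfloor$ are non-zero and this is a polynomial in $\sigma$; if $a=b=0$ it is a power series in $\sigma$. Slope condition: for $b>0$, $\underline{s}$ satisfies the slope condition for $(a,b)$-paths if for every $j\ge0$ and every $i=1,2,\ldots,b$, $s_{j+i}>s_j-1+ia/b$. By convention the slope condition is satisfied by every boundary for $(0,0)$-paths, and is not satisfied by any boundary for $(a,0)$-paths when $a>0$. *)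

(* Defs.v *)
From HB Require Import structures.
From mathcomp Require Import all_boot all_order all_algebra.
From mathcomp Require Import fraction finmap.
From mathcomp Require Import boolp classical_sets functions cardinality.

Set Implicit Arguments.
Unset Strict Implicit.
Unset Printing Implicit Defensive.

Import Order.TTheory GRing.Theory Num.Theory.
Local Open Scope ring_scope.

Record fps (R : Type) := FPS { fps_coef : nat -> R }.

Lemma fpsP (R : Type) (f g : fps R) : fps_coef f =1 fps_coef g <-> f = g.
Proof.
by split=> [|->//]; case: f g => [f] [g] /= /funext ->.
Qed.

HB.instance Definition _ (R : Type) := gen_eqMixin (fps R).
HB.instance Definition _ (R : Type) := gen_choiceMixin (fps R).

Section FpsZmodule.
Variable R : zmodType.
Implicit Types f g : fps R.

Definition fps_zero : fps R := FPS (fun=> 0).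
Definition fps_opp f := FPS (fun n => - fps_coef f n).
Definition fps_add f g := FPS (fun n => fps_coef f n + fps_coef g n).

Fact fps_addA : associative fps_add.
Proof. by move=> f g h; apply/fpsP => n /=; rewrite addrA. Qed.
Fact fps_addC : commutative fps_add.
Proof. by move=> f g; apply/fpsP => n /=; rewrite addrC. Qed.
Fact fps_add0 : left_id fps_zero fps_add.
Proof. by move=> f; apply/fpsP => n /=; rewrite add0r. Qed.
Fact fps_addN : left_inverse fps_zero fps_opp fps_add.
Proof. by move=> f; apply/fpsP => n /=; rewrite addNr. Qed.

HB.instance Definition _ :=
  GRing.isZmodule.Build (fps R) fps_addA fps_addC fps_add0 fps_addN.

End FpsZmodule.

Section FpsRing.
Variable R : comNzRingType.
Implicit Types f g h : fps R.

Definition fps_one : fps R := FPS (fun n => (n == 0)%:R).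
Definition fps_mul f g : fps R :=
  FPS (fun n => \sum_(i < n.+1) fps_coef f i * fps_coef g (n - i)).

Definition fps_trunc N f : {poly R} := \poly_(i < N) fps_coef f i.

Lemma coef_fps_mul N f g n : (n < N)%N ->
  fps_coef (fps_mul f g) n = (fps_trunc N f * fps_trunc N g)`_n.
Proof.
move=> ltnN; rewrite coefM /=; apply: eq_bigr => i _.
rewrite !coef_poly (leq_ltn_trans (leq_subr _ _) ltnN).
by rewrite (leq_trans (ltn_ord i)).
Qed.

Fact fps_mulA : associative fps_mul.
Proof.
move=> f g h; apply/fpsP => n.
have tr k : (k <= n)%N -> forall u, fps_coef u k = (fps_trunc n.+1 u)`_k.
  by move=> lekn u; rewrite coef_poly ltnS lekn.
transitivity (fps_trunc n.+1 f * (fps_trunc n.+1 g * fps_trunc n.+1 h))`_n.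
  rewrite coefM; apply: eq_bigr => i _; congr (_ * _).
    by apply: tr; rewrite -ltnS.
  by rewrite (@coef_fps_mul n.+1) // ltnS leq_subr.
rewrite mulrA coefM; apply: eq_bigr => i _; congr (_ * _).
  by rewrite (@coef_fps_mul n.+1).
by rewrite [RHS]tr // leq_subr.
Qed.
Fact fps_mulC : commutative fps_mul.
Proof.
by move=> f g; apply/fpsP => n; rewrite !(@coef_fps_mul n.+1) // mulrC.
Qed.
Fact fps_mul1 : left_id fps_one fps_mul.
Proof.
move=> f; apply/fpsP => n /=.
rewrite big_ord_recl /= mul1r subn0 big1 ?addr0 // => i _.
by rewrite /bump /= mul0r.
Qed.
Fact fps_mulD : left_distributive fps_mul +%R.
Proof.
move=> f g h; apply/fpsP => n /=; rewrite -big_split /=.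
by apply: eq_bigr => i _; rewrite mulrDl.
Qed.
Fact fps_one_neq0 : fps_one != 0.
Proof.
by apply/eqP => /fpsP/(_ 0%N)/eqP; rewrite /= oner_eq0.
Qed.

HB.instance Definition _ := GRing.Zmodule_isComNzRing.Build (fps R)
  fps_mulA fps_mulC fps_mul1 fps_mulD fps_one_neq0.

(* Units and inverses, by classical choice: [f] is a unit iff some [g] satisfies
   [g * f = 1], in which case [fps_inv f] is that [g]. *)
Definition fps_unit : {pred fps R} := [pred f | `[< exists g, g * f = 1 >]].
Definition fps_inv f : fps R := xget f [set g | g * f = 1].

Fact fps_mulV : {in fps_unit, left_inverse 1 fps_inv *%R}.
Proof.
move=> f /asboolP[g gf1]; rewrite /fps_inv.
by case: xgetP => [h _ //|/(_ g)].
Qed.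
Fact fps_unitP f g : g * f = 1 -> f \in fps_unit.
Proof. by move=> gf1; apply/asboolP; exists g. Qed.
Fact fps_inv_out : {in [predC fps_unit], fps_inv =1 id}.
Proof.
move=> f /asboolP nf; rewrite /fps_inv.
by case: xgetP => // g _ gf1; case: nf; exists g.
Qed.

HB.instance Definition _ := GRing.ComNzRing_hasMulInverse.Build (fps R)
  fps_mulV fps_unitP fps_inv_out.

End FpsRing.

Section FpsDomain.
Variable R : idomainType.

Fact fps_integral (f g : fps R) : f * g = 0 -> (f == 0) || (g == 0).
Proof.
have nz (u : fps R) : u != 0 -> exists n, fps_coef u n != 0.
  move=> u0; apply: contrapT => nu; case/eqP: u0; apply/fpsP => n /=.
  by apply/eqP; apply: contrapT => /negP un; apply: nu; exists n.
move=> fg0; have [//|/nz exf] := eqVneq f 0.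
apply: contrapT => /negP/nz exg.
case: (ex_minnP exf) => m fm mf; case: (ex_minnP exg) => n gn ng.
have := congr1 (fun u => fps_coef u (m + n)) fg0 => /=.
rewrite (bigD1 (Ordinal (leq_addr n m : m < (m + n).+1)%N)) //= addKn.
rewrite big1 ?addr0 => [/eqP|i].
  by rewrite mulf_eq0 (negPf fm) (negPf gn).
rewrite -val_eqE /= => im; have [ltim|leim] := ltnP i m.
  have [->|/mf] := eqVneq (fps_coef f i) 0; first by rewrite mul0r.
  by rewrite leqNgt ltim.
have [->|/ng] := eqVneq (fps_coef g (m + n - i)) 0; first by rewrite mulr0.
have ltmi : (m < i)%N by rewrite ltn_neqAle eq_sym im.
rewrite leq_subRL; last by rewrite -ltnS ltn_ord.
by rewrite leq_add2r leqNgt ltmi.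
Qed.

HB.instance Definition _ :=
  GRing.ComUnitRing_isIntegral.Build (fps R) fps_integral.

End FpsDomain.

Notation "{ 'fps' R }" := (fps R) (format "{ 'fps'  R }").

Local Notation "x %:F" := (FracField.tofrac x).

Section FracExt.
Variables (R S : idomainType) (f : {rmorphism R -> S}).

(* For injective [f], the extension of [f] to the fields of fractions; see
   [frac_extE]. *)
Definition frac_ext (x : {fraction R}) : {fraction S} :=
  (f (\n_(repr x)))%:F / (f (\d_(repr x)))%:F.

Lemma frac_repr (x : {fraction R}) : x = (\n_(repr x))%:F / (\d_(repr x))%:F.
Proof.
rewrite -[LHS]reprK; set r := repr x; unlock FracField.tofrac.
rewrite -[X in _ = _ * X]FracField.pi_inv -[RHS]FracField.pi_mul.
rewrite /FracField.mulf /FracField.invf.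
rewrite !numden_Ratio ?oner_neq0 ?denom_ratioP // mul1r mulr1.
by rewrite Ratio_numden.
Qed.

Hypothesis inj_f : injective f.

Lemma frac_extE n d : d != 0 -> frac_ext (n%:F / d%:F) = (f n)%:F / (f d)%:F.
Proof.
move=> d0; rewrite /frac_ext; set x := n%:F / d%:F.
have := frac_repr x; have := denom_ratioP (repr x).
move: (\n_(repr x)) (\d_(repr x)) => n' d' d'0 /eqP.
have fnz u : u != 0 -> (f u)%:F != 0.
  by move=> u0; rewrite tofrac_eq0 raddf_eq0.
rewrite eqr_div ?tofrac_eq0 // -!rmorphM tofrac_eq => /eqP e.
by apply/eqP; rewrite eqr_div ?fnz // -!rmorphM e.
Qed.

Lemma frac_ext_is_zmod_morphism : zmod_morphism frac_ext.
Proof.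
move=> x y; rewrite (frac_repr x) (frac_repr y).
have := denom_ratioP (repr x); have := denom_ratioP (repr y).
move: (\n_(repr x)) (\d_(repr x)) (\n_(repr y)) (\d_(repr y)) => n d n' d' d'0 d0.
have nz u : u != 0 -> u%:F != 0 :> {fraction R} by rewrite tofrac_eq0.
have fnz u : u != 0 -> (f u)%:F != 0.
  by move=> u0; rewrite tofrac_eq0 raddf_eq0.
rewrite -mulNr addf_div ?nz // -!(rmorphM, rmorphN, rmorphD) /=.
rewrite !frac_extE ?mulf_neq0 // -[in RHS]mulNr addf_div ?fnz //.
by rewrite -!(rmorphM, rmorphN, rmorphD).
Qed.

Lemma frac_ext_is_monoid_morphism : monoid_morphism frac_ext.
Proof.
split=> [|x y].
  rewrite -[X in frac_ext X](divr1 1) -(rmorph1 (@FracField.tofrac R)).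
  by rewrite frac_extE ?oner_neq0 // !rmorph1 divr1.
rewrite (frac_repr x) (frac_repr y).
have := denom_ratioP (repr x); have := denom_ratioP (repr y).
move: (\n_(repr x)) (\d_(repr x)) (\n_(repr y)) (\d_(repr y)) => n d n' d' d'0 d0.
rewrite mulf_div -!rmorphM /= !frac_extE ?mulf_neq0 //.
by rewrite mulf_div -!rmorphM.
Qed.

End FracExt.

(* [{poly {poly rat}}] and [{fps {fps rat}}] stand for Q[sigma][z] and
   Q[[sigma]][[z]]: the inner variable is sigma, the outer one is z. *)
Definition poly_fps (p : {poly {poly rat}}) : {fps {fps rat}} :=
  FPS (fun n => FPS (fun d => p`_n`_d)).

Lemma fps_coef_sum (R : zmodType) I (r : seq I) (P : pred I)
    (F : I -> {fps R}) d :
  fps_coef (\sum_(i <- r | P i) F i) d = \sum_(i <- r | P i) fps_coef (F i) d.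
Proof. by apply: (big_morph (fun u : {fps R} => fps_coef u d)). Qed.

Lemma poly_fps_is_zmod_morphism : zmod_morphism poly_fps.
Proof.
move=> p q; apply/fpsP => n; apply/fpsP => d /=.
by rewrite !coefB.
Qed.

Lemma poly_fps_is_monoid_morphism : monoid_morphism poly_fps.
Proof.
split=> [|p q]; apply/fpsP => n; apply/fpsP => d /=.
  by rewrite coef1; case: n => [|n] /=; rewrite ?coef1 ?coef0.
rewrite fps_coef_sum coefM coef_sum; apply: eq_bigr => i _.
by rewrite coefM.
Qed.

HB.instance Definition _ := GRing.isZmodMorphism.Build _ _ poly_fps
  poly_fps_is_zmod_morphism.
HB.instance Definition _ := GRing.isMonoidMorphism.Build _ _ poly_fps
  poly_fps_is_monoid_morphism.

Lemma poly_fps_inj : injective poly_fps.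
Proof.
move=> p q /fpsP pq; apply/polyP => n; apply/polyP => d.
by have /fpsP/(_ d) := pq n.
Qed.

Definition ratfun_fps :
  {fraction {poly {poly rat}}} -> {fraction {fps {fps rat}}} :=
  frac_ext poly_fps.

HB.instance Definition _ := GRing.isZmodMorphism.Build _ _ ratfun_fps
  (frac_ext_is_zmod_morphism poly_fps_inj).
HB.instance Definition _ := GRing.isMonoidMorphism.Build _ _ ratfun_fps
  (frac_ext_is_monoid_morphism poly_fps_inj).

Definition algebraic_fps (F : {fps {fps rat}}) : Prop :=
  algebraicOver ratfun_fps F%:F.

Definition boundary (s : nat -> nat) : Prop :=
  (forall n, 0 < s n)%N /\ {homo s : m n / (m <= n)%N}.

Definition periodic_boundary (s : nat -> nat) (k l : nat) : Prop :=
  [/\ boundary s, (0 < k)%N, s k.-1 = l &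
      forall m, s m = (s (m %% k) + m %/ k * l)%N].

(* The concatenation of [s1] and [p + s2], where [p] is the last term of [s1]
   ([p = 0] if [s1] is empty). *)
Definition concat_boundary (s1 : seq nat) (s2 : nat -> nat) : nat -> nat :=
  fun n => if (n < size s1)%N then nth 0%N s1 n
           else (last 0%N s1 + s2 (n - size s1))%N.

Definition ultimately_periodic (s : nat -> nat) (k r : nat) : Prop :=
  exists s1 s2 l,
    [/\ periodic_boundary s2 k l, size s1 = r & s =1 concat_boundary s1 s2].

Definition slope_condition (a b : nat) (s : nat -> nat) : Prop :=
  if b == 0%N then a = 0%N
  else forall j i, (1 <= i <= b)%N ->
    (s j)%:R - 1 + i%:R * a%:R / b%:R < (s (j + i)%N)%:R :> rat.

Inductive step := North | East | Diag.

Definition step_code (c : step) : 'I_3 :=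
  match c with
  | North => @Ordinal 3 0 isT | East => @Ordinal 3 1 isT
  | Diag => @Ordinal 3 2 isT
  end.
Definition step_decode (i : 'I_3) : step :=
  match val i with 0 => North | 1 => East | _ => Diag end.
Fact step_codeK : cancel step_code step_decode. Proof. by case. Qed.
HB.instance Definition _ := Finite.copy step (can_type step_codeK).

Section Paths.
Variables a b : nat.
Implicit Types (w : seq step) (c : step).

Definition displacement c : nat * nat :=
  match c with North => (0, 1) | East => (1, 0) | Diag => (a, b) end%N.

Definition endpoint w : nat * nat :=
  (\sum_(c <- w) (displacement c).1, \sum_(c <- w) (displacement c).2)%N.

(* Points are taken in Q^2. This loses nothing: the end points of a segment have
   integer coordinates, so a non-horizontal segment meets a line y = i in at most
   one point, which is rational, and the rightmost point of a horizontal one is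
   an end point. *)
Definition segment (p q : nat * nat) : set (rat * rat) :=
  [set z | exists t : rat,
    [/\ 0 <= t <= 1,
        z.1 = p.1%:R + t * (q.1%:R - p.1%:R) &
        z.2 = p.2%:R + t * (q.2%:R - p.2%:R)]].

Definition path_points w : set (rat * rat) :=
  [set z | z = (0, 0) \/
    exists u c v, w = u ++ c :: v /\
      segment (endpoint u) (endpoint (rcons u c)) z].

Definition rightmost w (i : nat) (x : rat) : Prop :=
  path_points w (x, i%:R) /\
  forall x', path_points w (x', i%:R) -> x' <= x.

Definition Right w (i : nat) : rat := xget 0 [set x | rightmost w i x].

Lemma endpoint_rcons w c :
  endpoint (rcons w c) = ((endpoint w).1 + (displacement c).1,
                          (endpoint w).2 + (displacement c).2)%N.
Proof. by rewrite /endpoint /= -!cats1 !big_cat !big_seq1. Qed.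

Lemma path_points_rcons w c z :
  path_points (rcons w c) z <->
  path_points w z \/ segment (endpoint w) (endpoint (rcons w c)) z.
Proof.
split=> [[->|[u [c' [v []]]]]|[[->|[u [c' [v [-> uz]]]]]|wz]].
- by left; left.
- case/lastP: v => [|v c''].
    by rewrite cats1 => /rcons_inj[-> ->]; right.
  by rewrite -rcons_cons -rcons_cat => /rcons_inj[-> _] uz; left; right; exists u, c', v.
- by left.
- by right; exists u, c', (rcons v c); rewrite rcons_cat.
- by right; exists w, c, [::]; rewrite cats1.
Qed.

Lemma path_points_meet w i :
  (i <= (endpoint w).2)%N -> exists x, path_points w (x, i%:R).
Proof.
elim/last_ind: w => [|w c IH].
  rewrite /endpoint /= big_nil leqn0 => /eqP ->.
  by exists 0; left.
rewrite endpoint_rcons /= => lei.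
have [/IH[x wx]|lti] := leqP i (endpoint w).2.
  by exists x; apply/path_points_rcons; left.
set y := (endpoint w).2 in lti lei.
set dy := (displacement c).2 in lei.
have dy0 : (0 < dy)%N by rewrite -(ltn_add2l y) addn0 (leq_trans lti).
pose t : rat := (i%:R - y%:R) / dy%:R.
have dy0' : dy%:R != 0 :> rat by rewrite pnatr_eq0 -lt0n.
exists ((endpoint w).1%:R + t * (((endpoint w).1 + (displacement c).1)%N%:R - (endpoint w).1%:R)).
apply/path_points_rcons; right.
rewrite /segment endpoint_rcons; exists t; split; last first; [|by []|] => /=.
  by rewrite -/y -/dy natrD addrAC subrr add0r divfK // addrC subrK.
rewrite divr_ge0 ?subr_ge0 ?ler_nat 1?ltnW //=.
by rewrite ler_pdivrMr ?ltr0n // mul1r lerBlDl -natrD ler_nat.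
Qed.

Lemma rightmost_exists w i :
  (exists x, path_points w (x, i%:R)) -> exists x, rightmost w i x.
Proof.
rewrite /rightmost; elim/last_ind: w => [|w c IH].
  case=> x [xi|[u [c [v []]]]]; last by case: u.
  exists x; split=> [|x' [x'i|[u [c [v []]]]]]; [by left| |by case: u].
  by case: xi => ->; case: x'i => ->.
pose S x := segment (endpoint w) (endpoint (rcons w c)) (x, i%:R).
have Smax : (exists x, S x) -> exists x, S x /\ forall x', S x' -> x' <= x.
  rewrite /S /segment endpoint_rcons /=.
  set y := (endpoint w).2; set x0 := (endpoint w).1.
  case: (displacement c) => dx dy /=; rewrite !natrD.
  have [->|dy0] := eqVneq dy 0%N.
    case=> _ [t [_ _ iy]]; exists (x0%:R + dx%:R); split.
      exists 1; split; rewrite ?ler01 ?lexx //; first by rewrite mul1r [RHS]addrC subrK.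
      by move: iy; rewrite addr0 subrr !mulr0.
    move=> x' [u [/andP[_ u1] -> _]]; rewrite lerD2l addrAC subrr add0r.
    by rewrite ler_piMl ?ler0n.
  case=> x Sx; exists x; split=> // x'.
  case: Sx => t [_ -> iy] [u [_ -> iy']].
  suff -> : u = t by [].
  have /addrI : y%:R + u * (y%:R + dy%:R - y%:R) =
                y%:R + t * (y%:R + dy%:R - y%:R) :> rat by rewrite -iy -iy'.
  rewrite addrAC subrr add0r; apply: mulIf.
  by rewrite pnatr_eq0.
case=> z0 wz0.
have [/IH[x [wx mx]]|nw] := pselect (exists x, path_points w (x, i%:R)).
  have [/Smax[z [Sz mz]]|nS] := pselect (exists x, S x).
    exists (Num.max x z); split.
      by apply/path_points_rcons; rewrite /Num.max; case: ifP => _; [right|left].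
    by move=> x' /path_points_rcons[/mx|/mz] h; rewrite le_max h ?orbT //.
  exists x; split=> [|x' /path_points_rcons[/mx //|Sx']].
    by apply/path_points_rcons; left.
  by case: nS; exists x'.
have [/Smax[z [Sz mz]]|nS] := pselect (exists x, S x).
  exists z; split=> [|x' /path_points_rcons[wx'|/mz //]].
    by apply/path_points_rcons; right.
  by case: nw; exists x'.
case: nS; exists z0; case/path_points_rcons: wz0 => // wz0.
by case: nw; exists z0.
Qed.

Lemma RightP w i : (i <= (endpoint w).2)%N -> rightmost w i (Right w i).
Proof.
move=> /path_points_meet/rightmost_exists[x wx].
by rewrite /Right; case: xgetP => [y -> //|/(_ x)].
Qed.

Definition bounded_path (s : nat -> nat) w : Prop :=
  forall i, (i < (endpoint w).2)%N -> Right w i < (s i)%:R.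

Definition Path (s : nat -> nat) (n d : nat) : set (seq step) :=
  [set w | [/\ endpoint w = ((s n).-1, n), bounded_path s w &
               count_mem Diag w = d]].

Lemma finite_Path s n d : finite_set (Path s n d).
Proof.
pose M := ((s n).-1 + n + d)%N.
apply: (@sub_finite_set _ _ (range (fun w : {bseq M of step} => val w))).
  move=> w [ew _ dw].
  suff szw : (size w <= M)%N by exists (Bseq szw).
  move: ew => [e1 e2]; rewrite /M -dw -{1}e1 -{1}e2.
  elim: w {e1 e2 dw} => //= c w IH; rewrite !big_cons.
  rewrite (addnACA (displacement c).1) addnACA -add1n leq_add //.
  by case: c; rewrite //= addn1.
exact/finite_image/finite_finset.
Qed.

Definition SP (s : nat -> nat) (n : nat) : {fps rat} :=
  FPS (fun d => (#|` fset_set (Path s n d)|)%:R).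

End Paths.

Definition SP_gf (a b : nat) (s : nat -> nat) : {fps {fps rat}} :=
  FPS (SP a b s).

Definition SP_section_gf (a b : nat) (s : nat -> nat) (k r j : nat) :
    {fps {fps rat}} :=
  FPS (fun q => if (r <= q)%N then SP a b s (q * k + j + r)%N else 0).

(* Main.v *)
(* Let T and Y be series with T + Y + sigma T^a Y^b = 1, and weight an east step
   by T, a north step by Y and a diagonal step by sigma T^a Y^b.  The slope
   condition forces a path to leave the region to the left of the boundary through
   an east step, from a point (s_n - 1, n); since all the weight leaves,
       sum_n SP_n T^(s_n) Y^n = 1.
   Parametrise T = G^(-k), Y = u G^l, so that T^l Y^k = u^k.  With B_j the section
   series and s_(r+j) the boundary on the first period, the identity becomes
       sum_(j < k) T^(s_(r+j)) Y^(r+j) B_j(u^k) = 1 - sum_(n < r) SP_n T^(s_n) Y^n.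
   The substitutions u -> omega^i u, for omega a primitive k-th root of unity, fix
   B_j(u^k) and turn it into a k x k linear system for the B_j(u^k) with algebraic
   coefficients, whose determinant reduces to a Vandermonde determinant at
   u = sigma = 0. *)
From HB Require Import structures.
Require Import Defs.
From mathcomp Require Import all_boot all_order all_algebra.
From mathcomp Require Import all_field.
From mathcomp Require Import fraction finmap.
From mathcomp Require Import boolp classical_sets cardinality.
From mathcomp Require Import ring lra zify.

Set Implicit Arguments.
Unset Strict Implicit.
Unset Printing Implicit Defensive.

Import Order.TTheory GRing.Theory Num.Theory.
Local Open Scope classical_set_scope.
Local Open Scope ring_scope.

Local Notation "x %:F" := (FracField.tofrac x).

(** * Formal power series and Hensel lifting *)

Section FpsMorphisms.
Variable R : comNzRingType.
Implicit Types f g : {fps R}.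

Definition fps_coef0 f := fps_coef f 0.

Fact fps_coef0_is_zmod_morphism : zmod_morphism fps_coef0.
Proof. by []. Qed.
Fact fps_coef0_is_monoid_morphism : monoid_morphism fps_coef0.
Proof. by split=> // f g; rewrite /fps_coef0 /= big_ord1. Qed.
HB.instance Definition _ :=
  GRing.isZmodMorphism.Build _ _ fps_coef0 fps_coef0_is_zmod_morphism.
HB.instance Definition _ :=
  GRing.isMonoidMorphism.Build _ _ fps_coef0 fps_coef0_is_monoid_morphism.

Definition fps_const (c : R) : {fps R} := FPS (fun n => if n is 0 then c else 0).

Lemma fps_coefCM c f n : fps_coef (fps_const c * f) n = c * fps_coef f n.
Proof. by rewrite /= big_ord_recl /= subn0 big1 ?addr0 // => i _; rewrite mul0r. Qed.

Fact fps_const_is_zmod_morphism : zmod_morphism fps_const.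
Proof. by move=> x y; apply/fpsP => -[|n] //=; rewrite subr0. Qed.
Fact fps_const_is_monoid_morphism : monoid_morphism fps_const.
Proof.
split=> [|x y]; apply/fpsP; first by case.
by move=> n; rewrite fps_coefCM; case: n => //= n; rewrite mulr0.
Qed.
HB.instance Definition _ :=
  GRing.isZmodMorphism.Build _ _ fps_const fps_const_is_zmod_morphism.
HB.instance Definition _ :=
  GRing.isMonoidMorphism.Build _ _ fps_const fps_const_is_monoid_morphism.

(** Substitution of [c z] for [z]; roots of unity [c] will give the conjugations behind the linear
    system. *)
Definition fps_scale (c : R) f : {fps R} := FPS (fun n => c ^+ n * fps_coef f n).

Fact fps_scale_is_zmod_morphism c : zmod_morphism (fps_scale c).
Proof. by move=> f g; apply/fpsP => n /=; rewrite mulrBr. Qed.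
Fact fps_scale_is_monoid_morphism c : monoid_morphism (fps_scale c).
Proof.
split=> [|f g]; apply/fpsP => n /=; first by case: n => [|n]; rewrite ?mulr1 ?mulr0.
rewrite mulr_sumr; apply: eq_bigr => i _.
by rewrite mulrACA -exprD subnKC // -ltnS.
Qed.
HB.instance Definition _ c :=
  GRing.isZmodMorphism.Build _ _ (fps_scale c) (fps_scale_is_zmod_morphism c).
HB.instance Definition _ c :=
  GRing.isMonoidMorphism.Build _ _ (fps_scale c) (fps_scale_is_monoid_morphism c).

(* Substitution of [z ^ k] for [z]. *)
Definition fps_spread (k : nat) f : {fps R} :=
  FPS (fun n => if (k %| n)%N then fps_coef f (n %/ k) else 0).

Fact fps_spread_is_zmod_morphism k : zmod_morphism (fps_spread k).
Proof. by move=> f g; apply/fpsP => n /=; case: ifP => //; rewrite subr0. Qed.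
Fact fps_spread_is_monoid_morphism k : monoid_morphism (fps_spread k).
Proof.
split=> [|f g]; apply/fpsP => n /=.
  case: n => [|n]; first by rewrite dvdn0 div0n.
  by case: ifP => // /dvdnP[[//|q] ->]; case: k => [|k]; rewrite ?muln0 // mulnK.
(* For [k = 0] the conventions for division by zero keep only the constant term, and the map is
   still multiplicative. *)
case: k => [|k].
  rewrite dvd0n divn0; case: eqP => [->|n0]; first by rewrite !big_ord1.
  symmetry; apply: big1 => i _; rewrite !dvd0n.
  case: eqP => [->|_]; last by rewrite mul0r.
  by rewrite subn0; case: eqP => //; rewrite mulr0.
case: ifPn => [/dvdnP[m ->]|ndv]; last first.
  symmetry; apply: big1 => i _; case: ifP => [ki|_]; last by rewrite mul0r.
  by rewrite dvdn_subl ?(negPf ndv) ?mulr0 // -ltnS.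
(* Only the indices divisible by [k.+1] contribute; they are reindexed by their quotients. *)
rewrite mulnK // [RHS](bigID (fun i : 'I__ => k.+1 %| i)%N) /=.
rewrite [X in _ = _ + X]big1 ?addr0 => [|i /negPf ->]; last by rewrite mul0r.
have lt_ (j : 'I_m.+1) : (j * k.+1 < (m * k.+1).+1)%N.
  by rewrite ltnS leq_mul2r -ltnS ltn_ord orbT.
have le_ (i : 'I_(m * k.+1).+1) : (i %/ k.+1 < m.+1)%N.
  by rewrite ltnS -(@leq_pmul2r k.+1) // (leq_trans (leq_trunc_div _ _)) // -ltnS.
rewrite (reindex_onto (fun j => Ordinal (lt_ j)) (fun i => Ordinal (le_ i))); last first.
  by move=> i ki; apply: val_inj; rewrite /= divnK.
apply: eq_big => [j|j _] /=.
  by rewrite dvdn_mull //=; symmetry; apply/eqP/val_inj; rewrite /= mulnK.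
by rewrite dvdn_mull // -mulnBl dvdn_mull // !mulnK.
Qed.
HB.instance Definition _ k :=
  GRing.isZmodMorphism.Build _ _ (fps_spread k) (fps_spread_is_zmod_morphism k).
HB.instance Definition _ k :=
  GRing.isMonoidMorphism.Build _ _ (fps_spread k) (fps_spread_is_monoid_morphism k).

Lemma fps_spread_inj k : (0 < k)%N -> injective (fps_spread k).
Proof.
move=> k0 f g /fpsP fg; apply/fpsP => n.
by have := fg (n * k)%N; rewrite /= dvdn_mull // mulnK.
Qed.

Lemma fps_coef0_scale c f : fps_coef0 (fps_scale c f) = fps_coef0 f.
Proof. by rewrite /fps_coef0 /= mul1r. Qed.

Lemma fps_scale_spread c k f : c ^+ k = 1 ->
  fps_scale c (fps_spread k f) = fps_spread k f.
Proof.
move=> ck; apply/fpsP => n /=; case: ifP => [/dvdnP[m ->]|_]; last by rewrite mulr0.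
by rewrite mulnC exprM ck expr1n mul1r.
Qed.

Definition fps_X : {fps R} := FPS (fun n => (n == 1)%N%:R).

Lemma fps_coefXM f n :
  fps_coef (fps_X * f) n = if n is m.+1 then fps_coef f m else 0.
Proof.
case: n => [|n] /=; first by rewrite big_ord1 /= mul0r.
rewrite big_ord_recl /= mul0r add0r big_ord_recl /= mul1r big1 ?addr0 //.
  by congr fps_coef; rewrite /bump /=; lia.
by move=> i _; rewrite /= mul0r.
Qed.

Lemma fps_coefXnM m f n :
  fps_coef (fps_X ^+ m * f) n = if (n < m)%N then 0 else fps_coef f (n - m).
Proof.
elim: m n => [|m IH] n; first by rewrite mul1r subn0.
by rewrite exprS -mulrA fps_coefXM; case: n => // n; rewrite IH ltnS subSS.
Qed.

Lemma fps_coefXn m n : fps_coef (fps_X ^+ m) n = (n == m)%:R.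
Proof.
rewrite -[fps_X ^+ m]mulr1 fps_coefXnM; case: ltngtP => //= [mn|->].
  by rewrite subn_eq0 leqNgt mn.
by rewrite subnn.
Qed.

Lemma fps_spreadX k : (0 < k)%N -> fps_spread k fps_X = fps_X ^+ k.
Proof.
move=> k0; apply/fpsP => n; rewrite fps_coefXn /=.
case: ifP => [/dvdnP[m ->]|]; last by case: eqP => // ->; rewrite dvdnn.
by rewrite mulnK // -{2}[k]mul1n eqn_pmul2r.
Qed.

Lemma fps_scaleX c : fps_scale c fps_X = fps_const c * fps_X.
Proof.
apply/fpsP => n; rewrite fps_coefCM /=.
by case: n => [|[|n]]; rewrite ?mulr0 // expr1.
Qed.

Lemma fps_spreadC k c : fps_spread k (fps_const c) = fps_const c.
Proof.
apply/fpsP => n /=; case: ifP => [/dvdnP[m ->]|]; last by case: n => //; rewrite dvdn0.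
by case: k => [|k]; rewrite ?muln0 // mulnK //; case: m.
Qed.

Lemma fps_coefM_lt f g n : (forall i, (i <= n)%N -> fps_coef g i = 0) ->
  fps_coef (f * g) n = 0.
Proof. by move=> g0; apply: big1 => i _; rewrite g0 ?mulr0 ?leq_subr. Qed.

End FpsMorphisms.

Arguments fps_X {R}.
Arguments fps_coef0 : simpl never.

Section FpsMap.
Variables (R S : comNzRingType) (h : {rmorphism R -> S}).

Definition fps_map (f : {fps R}) : {fps S} := FPS (fun n => h (fps_coef f n)).

Fact fps_map_is_zmod_morphism : zmod_morphism fps_map.
Proof. by move=> f g; apply/fpsP => n /=; rewrite rmorphB. Qed.
Fact fps_map_is_monoid_morphism : monoid_morphism fps_map.
Proof.
split=> [|f g]; apply/fpsP => n /=; first by rewrite rmorph_nat.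
by rewrite rmorph_sum; apply: eq_bigr => i _; rewrite rmorphM.
Qed.
HB.instance Definition _ :=
  GRing.isZmodMorphism.Build _ _ fps_map fps_map_is_zmod_morphism.
HB.instance Definition _ :=
  GRing.isMonoidMorphism.Build _ _ fps_map fps_map_is_monoid_morphism.

Lemma fps_map_inj : injective h -> injective fps_map.
Proof. by move=> hI f g /fpsP fg; apply/fpsP => n; apply/hI/fg. Qed.

Lemma fps_mapX : fps_map fps_X = fps_X.
Proof. by apply/fpsP => n /=; rewrite rmorph_nat. Qed.

Lemma fps_mapC c : fps_map (fps_const c) = fps_const (h c).
Proof. by apply/fpsP => -[|n] //=; rewrite rmorph0. Qed.

End FpsMap.

Lemma rmorph_trinomial (A B : comNzRingType) (h : {rmorphism A -> B}) x u v k b m n :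
  x ^+ k = 1 + u * x ^+ m + v * u ^+ b * x ^+ n ->
  h x ^+ k = 1 + h u * h x ^+ m + h v * h u ^+ b * h x ^+ n.
Proof. by move=> /(congr1 h); rewrite !(rmorphD, rmorphM, rmorphXn, rmorph1). Qed.

Lemma fps_map_spread (R S : comNzRingType) (h : {rmorphism R -> S}) k f :
  fps_map h (fps_spread k f) = fps_spread k (fps_map h f).
Proof. by apply/fpsP => n /=; case: ifP => // _; rewrite rmorph0. Qed.

(** Truncation at order [M], for proving identities of series modulo each power of the variable. *)
Lemma fps_split (R : comNzRingType) (f : {fps R}) M :
  exists t, f = \sum_(q < M) fps_const (fps_coef f q) * fps_X ^+ q + fps_X ^+ M * t.
Proof.
exists (FPS (fun n => fps_coef f (M + n))); apply/fpsP => n.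
rewrite -[RHS]/(fps_coef _ n + fps_coef _ n) fps_coef_sum fps_coefXnM.
have [nM|Mn] := ltnP n M; last first.
  rewrite [fps_coef (FPS _) _]/= subnKC // big1 ?add0r // => q _.
  by rewrite fps_coefCM fps_coefXn gtn_eqF ?mulr0 // (leq_trans _ Mn).
rewrite addr0 (bigD1 (Ordinal nM)) // big1 ?addr0 => [|q qn].
  by rewrite fps_coefCM fps_coefXn eqxx mulr1 [RHS]addr0.
rewrite fps_coefCM fps_coefXn eq_sym.
by rewrite -val_eqE in qn; rewrite (negPf qn) mulr0.
Qed.

Lemma sum_blocks (V : nmodType) (g : nat -> V) k M :
  \sum_(n < M * k) g n = \sum_(q < M) \sum_(j < k) g (q * k + j)%N.
Proof.
elim: M => [|M IH]; first by rewrite !big_ord0.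
rewrite big_ord_recr -IH /= -!(big_mkord xpredT g) mulSn addnC.
rewrite (big_cat_nat _ (leq_addr k (M * k))) //=; congr (_ + _).
rewrite -{1}[(M * k)%N]add0n big_addn addKn big_mkord.
by apply: eq_bigr => i _; rewrite addnC.
Qed.

Lemma horner_taylor2 (R : comNzRingType) (p : {poly R}) x h :
  exists q, p.[x + h] = p.[x] + h * p^`().[x] + h * h * q.
Proof.
elim/poly_ind: p => [|p c [q IH]].
  by exists 0; rewrite deriv0 !horner0 !mulr0 !addr0.
exists (p^`().[x] + q * (x + h)).
rewrite derivD derivC derivM derivX addr0 mulr1 !hornerE IH; ring.
Qed.

Section Hensel.
Variables (R : comNzRingType) (p : {poly {fps R}}) (g0 : {fps R}) (v : R).
Hypothesis root0 : fps_coef p.[g0] 0 = 0.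
Hypothesis unit0 : v * fps_coef p^`().[g0] 0 = 1.

(** Newton iteration with the fixed inverse [v] of the constant term of the derivative: step [n]
    adjusts the coefficient of order [n] alone, so as to cancel that of the value of [p]. *)
Fixpoint hensel_approx n : {fps R} :=
  if n is m.+1 then
    let g := hensel_approx m in
    g - fps_X ^+ n * fps_const (v * fps_coef p.[g] n)
  else g0.

Lemma hensel_approx_lt m n i : (i <= m)%N -> (m <= n)%N ->
  fps_coef (hensel_approx n) i = fps_coef (hensel_approx m) i.
Proof.
move=> im; elim: n => [|n IH]; first by rewrite leqn0 => /eqP ->.
rewrite leq_eqVlt => /predU1P[-> //|mn]; rewrite -IH //.
rewrite [hensel_approx n.+1]/= -[LHS]/(fps_coef _ _ - fps_coef _ _).
by rewrite fps_coefXnM ltnS (leq_trans im mn) subr0.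
Qed.

Lemma hensel_approx_root n i : (i <= n)%N ->
  fps_coef p.[hensel_approx n] i = 0.
Proof.
elim: n i => [|n IH] i; first by rewrite leqn0 => /eqP ->.
rewrite /= -/hensel_approx; set g := hensel_approx n in IH *.
set c := v * _ => lei.
have d0 : fps_coef p^`().[g] 0 = fps_coef p^`().[g0] 0.
  rewrite -![fps_coef _ 0]/(fps_coef0 _) -!horner_map /=; congr _.[_].
  by rewrite /fps_coef0 (@hensel_approx_lt 0).
(* The quadratic remainder has order at least [2n + 2], so in order [n.+1] only the linear term
   acts, and [c] was chosen for it to cancel. *)
have [q ->] := horner_taylor2 p g (- (fps_X ^+ n.+1 * fps_const c)).
rewrite mulrNN mulNr -!mulrA.
rewrite -[LHS]/(fps_coef _ _ + - fps_coef _ _ + fps_coef _ _).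
rewrite !fps_coefXnM; case: ltngtP lei => // [lti|->] _.
  by rewrite IH // subr0 addr0.
rewrite subnn !fps_coefCM fps_coefXnM ltn0Sn mulr0 addr0.
by rewrite d0 /c mulrAC unit0 mul1r subrr.
Qed.

Lemma hensel : exists2 g, p.[g] = 0 & fps_coef g 0 = fps_coef g0 0.
Proof.
(* The limit is read on the diagonal, since the coefficient of order [n] is final from step [n] on.
   It agrees with step [n] up to order [n], and so do the values of [p]. *)
exists (FPS (fun n => fps_coef (hensel_approx n) n)) => //.
set g := FPS _; apply/fpsP => n; rewrite [RHS]/=.
have [q ] := horner_taylor2 p (hensel_approx n) (g - hensel_approx n).
rewrite addrC subrK -addrA -mulrA -mulrDr mulrC => ->.
rewrite -[LHS]/(fps_coef _ _ + fps_coef _ _) hensel_approx_root // add0r.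
apply: fps_coefM_lt => i lei.
by rewrite -[LHS]/(fps_coef g i - _) /= (hensel_approx_lt (leqnn i) lei) subrr.
Qed.

End Hensel.

(** * Words whose prefixes end inside the boundary *)

Section Words.
Variables (a b : nat) (s : nat -> nat).
Implicit Types (w : seq step) (c : step).

Local Notation endpoint := (endpoint a b).
Local Notation path_points := (path_points a b).

Definition inside (z : nat * nat) : bool := (z.1 < s z.2)%N.

(** Testing only the end points of prefixes turns the geometric bound into a condition that can be
    followed step by step; see [inside_pathP]. *)
Definition inside_path w : Prop := forall u v, w = u ++ v -> inside (endpoint u).

Lemma inside_path_nil : inside_path [::] <-> (0 < s 0)%N.
Proof.
have e0 : endpoint [::] = (0, 0)%N by rewrite /endpoint !big_nil.
split=> [/(_ [::] [::] erefl)|s0 [|//] v _]; by rewrite e0.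
Qed.

Lemma inside_path_rcons w c :
  inside_path (rcons w c) <-> inside_path w /\ inside (endpoint (rcons w c)).
Proof.
split=> [okw|[okw ewc] u v].
  split=> [u v wuv|]; last by apply: (okw _ [::]); rewrite cats0.
  by apply: (okw u (rcons v c)); rewrite wuv rcons_cat.
case/lastP: v => [|v d]; first by rewrite cats0 => <-.
by rewrite -rcons_cat => /rcons_inj[/okw].
Qed.

Lemma inside_endpoint w : inside_path w -> inside (endpoint w).
Proof. by move/(_ w [::]); rewrite cats0; apply. Qed.

Lemma path_points_endpoint w :
  path_points w ((endpoint w).1%:R, (endpoint w).2%:R).
Proof.
case/lastP: w => [|w c]; first by left; rewrite /endpoint !big_nil.
apply/path_points_rcons; right; exists 1.
by rewrite ler01 lexx /= !mul1r; split=> //; rewrite addrC subrK.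
Qed.

(** No step goes left or down. *)
Lemma path_points_le w z : path_points w z ->
  z.1 <= (endpoint w).1%:R /\ z.2 <= (endpoint w).2%:R.
Proof.
elim/last_ind: w z => [|w c IH] z.
  by case=> [->|[u [d [v []]]]]; [rewrite /= !ler0n | case: u].
case/path_points_rcons => [/IH|[t [t01 -> ->]]].
  rewrite endpoint_rcons /= !natrD; set x := (endpoint w).1; set y := (endpoint w).2.
  have := ler0n rat (displacement a b c).1; have := ler0n rat (displacement a b c).2.
  by move=> *; split; lra.
rewrite endpoint_rcons /= !natrD.
have := ler0n rat (displacement a b c).1; have := ler0n rat (displacement a b c).2.
set x : rat := (endpoint w).1%:R; set y : rat := (endpoint w).2%:R.
move: (_%:R) (_%:R) => dy dx dy0 dx0; case/andP: t01 => t0 t1.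
by rewrite ![_ + _ - _]addrAC !subrr !add0r !lerD2l !ler_piMl.
Qed.

Lemma bounded_pathP w : bounded_path a b s w <->
  forall i x, (i < (endpoint w).2)%N -> path_points w (x, i%:R) -> x < (s i)%:R.
Proof.
split=> [bw i x lti wx|bw i lti].
  by apply: le_lt_trans (bw i lti); case: (RightP (ltnW lti)) => _; apply.
by case: (RightP (ltnW lti)) => /bw + _; apply.
Qed.

Hypothesis bd : boundary s.
Hypothesis slope : slope_condition a b s.

(** The left side is the abscissa at height [i] of a diagonal step started at [(x, y)]; for [i > y]
    the slope condition applies because [x] is at most [s y - 1]. *)
Lemma slope_segment x y i : inside (x, y) -> (y <= i)%N -> (i < y + b)%N ->
  x%:R + (i - y)%N%:R * (a%:R / b%:R) < (s i)%:R :> rat.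
Proof.
rewrite /inside /= => xs yi iy; have [/(congr1 (addn^~ y)) |iy0] := eqVneq (i - y)%N 0%N.
  by rewrite subnK // add0n => ->; rewrite subnn mul0r addr0 ltr_nat.
have b0 : b != 0%N by apply: contraTneq iy => ->; rewrite addn0 -leqNgt.
move: slope; rewrite /slope_condition (negPf b0) => /(_ y (i - y)%N).
rewrite lt0n iy0 leq_subLR (ltnW iy) subnKC // => /(_ isT); apply: le_lt_trans.
by rewrite mulrA lerD2r lerBrDr natr1 ler_nat.
Qed.

(** Induction on the last step. The slope condition keeps a diagonal step that starts inside within
    the bound at all heights below its end; conversely, the start of a rising last step lies at a
    height that the bound covers. *)
Lemma inside_pathP w :
  inside_path w <-> bounded_path a b s w /\ inside (endpoint w).
Proof.
elim/last_ind: w => [|w c IH].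
  rewrite inside_path_nil /bounded_path /inside /endpoint !big_nil /=.
  by split=> [s0|[]].
rewrite inside_path_rcons; split=> [[okw ins]|[bw ins]]; split=> //.
  have ew := inside_endpoint okw; have [/bounded_pathP bw _] := IH.1 okw.
  (* The boundary does not decrease, so the abscissa of the end of [w] is allowed at all greater
     heights. *)
  have end_ok i : ((endpoint w).2 <= i)%N -> ((endpoint w).1%:R < (s i)%:R :> rat).
    move=> lei; rewrite ltr_nat; apply: leq_trans ew _; exact: bd.2.
  apply/bounded_pathP => i x lti /path_points_rcons[wx|].
    have [/bw/(_ wx)//|lei] := ltnP i (endpoint w).2.
    by have [/= xe _] := path_points_le wx; apply: le_lt_trans xe (end_ok _ lei).
  rewrite endpoint_rcons in lti ins *; case=> t [/andP[t0 t1] /= -> iy].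
  rewrite !natrD ![_ + _ - _]addrAC !subrr !add0r in iy *.
  have yi : ((endpoint w).2 <= i)%N.
    by rewrite -(ler_nat rat) iy lerDl mulr_ge0.
  case: c ins lti iy => /= ins lti iy.
  - by rewrite mulr0 addr0 end_ok.
  - by rewrite addn0 ltnNge yi in lti.
  - have b0 : b%:R != 0 :> rat.
      by rewrite pnatr_eq0 -lt0n -(ltn_add2l (endpoint w).2) addn0 (leq_ltn_trans yi).
    have -> : t = (i - (endpoint w).2)%N%:R / b%:R.
      by rewrite natrB // iy addrC addKr mulfK.
    by rewrite mulrAC -mulrA slope_segment // -surjective_pairing.
apply/IH; split.
  apply/bounded_pathP => i x lti wx; move/bounded_pathP: bw; apply.
    by rewrite endpoint_rcons /= ltn_addr.
  by apply/path_points_rcons; left.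
rewrite endpoint_rcons in ins; rewrite /inside.
(* Removing a flat last step stays inside, as the abscissa can only drop. *)
have [dy0|dy0] := posnP (displacement a b c).2.
  by move: ins; rewrite /inside /= dy0 addn0; apply: leq_ltn_trans; rewrite leq_addr.
rewrite -(ltr_nat rat); move/bounded_pathP: bw; apply.
  by rewrite endpoint_rcons /= -[X in (X < _)%N]addn0 ltn_add2l.
by apply/path_points_rcons; left; apply: path_points_endpoint.
Qed.

(** For [b > 0] this is the case [i = b] of the slope condition, in integers. The diagonal
    predecessor of a point outside the region is outside, so no diagonal step leaves the region. *)
Lemma slope_shift n : (b <= n)%N -> (s (n - b) + a <= s n)%N.
Proof.
move=> bn; move: slope; rewrite /slope_condition.
have [-> ->|b0] := eqVneq b 0%N; first by rewrite subn0 addn0.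
move/(_ (n - b)%N b); rewrite lt0n b0 leqnn => /(_ isT).
rewrite mulrAC divff ?pnatr_eq0 // mul1r subnK // addrAC ltrBlDr.
by rewrite -natrD -[1]/(1%:R) -natrD ltr_nat addn1 ltnS.
Qed.

Definition words_to (x n d : nat) : set (seq step) :=
  [set w | [/\ endpoint w = (x, n), inside_path w & count_mem Diag w = d]].

Lemma PathE n d : Path a b s n d = words_to (s n).-1 n d.
Proof.
apply/seteqP; split=> w [ew]; rewrite /words_to /Path /=.
  move=> bw dw; split=> //; apply/inside_pathP; split=> //.
  by rewrite ew /inside /= prednK // bd.1.
by move=> /inside_pathP[].
Qed.

Lemma finite_words_to x n d : finite_set (words_to x n d).
Proof.
pose M := (x + n + d)%N.
apply: (@sub_finite_set _ _ (range (fun w : {bseq M of step} => val w))).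
  move=> w [ew _ dw].
  suff szw : (size w <= M)%N by exists (Bseq szw).
  rewrite /M -dw; case: ew => <- <-.
  elim: w {dw} => //= c w IH; rewrite !big_cons.
  rewrite (addnACA (displacement a b c).1) addnACA -add1n leq_add //.
  by case: c; rewrite //= addn1.
exact/finite_image/finite_finset.
Qed.

End Words.

(** Words are sorted by their last letter, whose removal is injective on each class; this is the
    source of the recursion on paths. *)
Lemma card_seqs_rcons (A : set (seq step)) : finite_set A ->
  #|` fset_set A| = (`[< A (@nil step) >]
    + #|` fset_set [set w : seq step | A (rcons w North)]|
    + #|` fset_set [set w : seq step | A (rcons w East)]|
    + #|` fset_set [set w : seq step | A (rcons w Diag)]|)%N.
Proof.
move=> finA; pose B (c : step) := [set w : seq step | A (rcons w c)].
have injr (c : step) : injective (fun w => rcons w c) by move=> u v /rcons_inj[].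
have finB c : finite_set (B c).
  apply: (@finite_preimage _ _ A (fun w : seq step => rcons w c)) => // u v _ _; exact: injr.
have -> : fset_set A = ((if `[< A (@nil step) >] then [fset (@nil step)] else fset0) `|`
    (fun w : seq step => rcons w North) @` fset_set (B North) `|`
    (fun w : seq step => rcons w East) @` fset_set (B East) `|`
    (fun w : seq step => rcons w Diag) @` fset_set (B Diag))%fset.
  apply/fsetP => w; rewrite !inE in_fset_set //; apply/idP/idP.
    rewrite inE; case/lastP: w => [|w c] Aw; first by rewrite asboolT // inE.
    have: rcons w c \in ((fun w : seq step => rcons w c) @` fset_set (B c))%fset.
      by apply/imfsetP; exists w; rewrite //= in_fset_set // inE.
    by case: c {Aw} => ->; rewrite ?orbT.
  case/orP => [/orP[/orP[]|]|].
  - by case: asboolP => // A0; rewrite inE => /eqP ->; rewrite inE.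
  - by case/imfsetP => v /=; rewrite in_fset_set // inE => Av ->; rewrite inE.
  - by case/imfsetP => v /=; rewrite in_fset_set // inE => Av ->; rewrite inE.
  - by case/imfsetP => v /=; rewrite in_fset_set // inE => Av ->; rewrite inE.
have dis c (X : {fset seq step}) : (forall w, rcons w c \notin X) ->
    #|` (X `|` (fun w : seq step => rcons w c) @` fset_set (B c))%fset| =
    (#|` X| + #|` fset_set (B c)|)%N.
  move=> nX; rewrite cardfsU (card_imfset _ _ (@injr c)) /=.
  rewrite (_ : (X `&` _)%fset = fset0) ?cardfs0 ?subn0 //.
  apply/fsetP => w; rewrite !inE; apply/negP => /andP[wX /imfsetP[v /= _ e]].
  by move: wX; rewrite e (negPf (nX _)).
have nrcons w c c' (X : {fset seq step}) : c != c' ->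
    rcons w c \in ((fun w : seq step => rcons w c') @` X)%fset = false.
  by move=> cc'; apply/negP => /imfsetP[v _ /rcons_inj[_ e]]; rewrite e eqxx in cc'.
have nnil w c :
    rcons w c \in (if `[< A (@nil step) >] then [fset (@nil step)] else fset0)%fset = false.
  by case: asbool; [rewrite in_fset1; case: w | rewrite in_fset0].
rewrite !dis; first by congr (_ + _ + _ + _)%N; case: ifP => _; rewrite ?cardfs1 ?cardfs0.
all: by move=> w; rewrite ?inE ?nnil ?nrcons.
Qed.

(** * The total mass identity *)

Section WordSeries.
Variables (a b : nat) (s : nat -> nat).

Definition word_series (x n : nat) : {fps rat} :=
  FPS (fun d => #|` fset_set (words_to a b s x n d)|%:R).

Hypothesis bd : boundary s.
Hypothesis slope : slope_condition a b s.

Lemma SP_word_series n : SP a b s n = word_series (s n).-1 n.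
Proof. by apply/fpsP => d /=; rewrite (PathE bd slope). Qed.

Lemma word_series_out x n : (s n <= x)%N -> word_series x n = 0.
Proof.
move=> sx; apply/fpsP => d /=; rewrite (_ : words_to _ _ _ _ _ _ = set0) ?fset_set0 //.
apply/seteqP; split=> // w [ew /inside_endpoint + _].
by rewrite ew /inside /= ltnNge sx.
Qed.

Lemma words_to_nil x n d :
  words_to a b s x n d [::] <-> [/\ x = 0%N, n = 0%N & d = 0%N].
Proof.
rewrite /words_to /= /endpoint !big_nil.
split=> [[[<- <-] _ <-]//|[-> -> ->]]; split=> //.
by apply/inside_path_nil/bd.1.
Qed.

Lemma words_to_rcons x n d c : (x < s n)%N ->
  [set w | words_to a b s x n d (rcons w c)] =
  let: (dx, dy) := displacement a b c in
  if [&& (dx <= x)%N, (dy <= n)%N & ((c == Diag) <= d)%N]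
  then words_to a b s (x - dx) (n - dy) (d - (c == Diag)) else set0.
Proof.
move=> xs; case e : (displacement a b c) => [dx dy].
have cw w : count_mem Diag (rcons w c) = (count_mem Diag w + (c == Diag))%N.
  by rewrite -cats1 count_cat /= addn0.
apply/seteqP; split=> w; rewrite /words_to /= cw endpoint_rcons e /=.
  case=> -[<- <-] /inside_path_rcons[okw _] <-.
  by rewrite !leq_addl /= !addnK; split=> //; case: (endpoint a b w).
case: ifP => // /and3P[dxx dyn cd] [ew okw dw].
case: (ew) => -> ->; rewrite dw !subnK //; split=> //.
by apply/inside_path_rcons; rewrite endpoint_rcons ew e /inside /= !subnK.
Qed.

(** Remove the last step of a path. Here [fps_X] is sigma, which marks diagonal steps. *)
Lemma word_series_rec x n : (x < s n)%N ->
  word_series x n = ((x == 0%N) && (n == 0%N))%:R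
    + (if (0 < x)%N then word_series x.-1 n else 0)
    + (if (0 < n)%N then word_series x n.-1 else 0)
    + fps_X * (if (a <= x)%N && (b <= n)%N then word_series (x - a) (n - b) else 0).
Proof.
move=> xs; apply/fpsP => d.
rewrite -[RHS]/(fps_coef _ d + fps_coef _ d + fps_coef _ d + fps_coef _ d) fps_coefXM.
rewrite /= card_seqs_rcons; last exact: finite_words_to.
rewrite !words_to_rcons //= !subn0 !subn1 !andbT !natrD.
have ifS (c : bool) (A : set (seq step)) :
    #|` fset_set (if c then A else set0)|%:R = if c then #|` fset_set A|%:R else 0 :> rat.
  by case: c => //; rewrite fset_set0.
rewrite !ifS; congr (_ + _); first rewrite addrAC; first congr (_ + _ + _).
- case: asboolP => [/words_to_nil[-> -> ->]//|nw].
  case: andP => [[/eqP x0 /eqP n0]|_]; last by [].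
  by case: d nw => // [] []; apply/words_to_nil.
- by case: ifP.
- by case: ifP.
- case: d {ifS} => [|d]; first by rewrite !andbF.
  by rewrite ?subn1 ?andbT; case: ifP.
Qed.

(** The polynomial variable marks the abscissa; the coefficients are series in sigma. *)
Definition row_poly (n : nat) : {poly {fps rat}} := \poly_(x < s n) word_series x n.

Lemma coef_row_poly n x : (row_poly n)`_x = word_series x n.
Proof. by rewrite coef_poly; case: ltnP => // /word_series_out ->. Qed.

(** This is [word_series_rec] as an identity between rows. The subtracted term records the east
    steps out of the region from [(s n - 1, n)], the only way out. *)
Lemma row_poly_rec n :
  (1 - 'X) * row_poly n = ((n == 0%N)%:R)%:P + (if (0 < n)%N then row_poly n.-1 else 0)
    + fps_X%:P * ('X^a * (if (b <= n)%N then row_poly (n - b) else 0))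
    - (SP a b s n)%:P * 'X^(s n).
Proof.
apply/polyP => x; rewrite mulrBl mul1r !(coefD, coefN, coefCM, coefXM, coefXnM, coefXn).
rewrite mulr_natr SP_word_series.
have ifc (c : bool) m y : (if c then row_poly m else 0)`_y = if c then word_series y m else 0.
  by case: c; rewrite ?coef0 ?coef_row_poly.
rewrite !ifc !coef_row_poly coefC.
have sle m y : (m <= n)%N -> (s n <= y)%N -> word_series y m = 0.
  by move=> mn sy; apply: word_series_out; apply: leq_trans sy; apply: bd.2.
(* Inside the region this is the recursion; beyond [s n] every term vanishes; at [s n] only the exit
   term remains on both sides. *)
case: (ltngtP x (s n)) => [xs|sx|->].
- rewrite subr0 [in LHS]word_series_rec //.
  by case: (ltnP x a) => ax; case: (x) => [|x'] /=; ring.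
- have x0 : (x == 0%N) = false by apply: negbTE; rewrite -lt0n; apply: leq_trans sx.
  rewrite x0 mulr0n subr0 sle ?(ltnW sx) // sle //; last by rewrite -ltnS prednK // lt0n x0.
  rewrite ?subr0 ?add0r ?oppr0.
  rewrite (_ : (if (0 < n)%N then _ else _) = 0); last first.
    by case: ifP => // n0; rewrite sle ?leq_pred // ltnW.
  rewrite (_ : (if (x < a)%N then _ else _) = 0); last first.
    case: ifP => // ax; case: ifP => // bn; rewrite word_series_out //.
    by have := slope_shift slope bn; lia.
  by rewrite mulr0 !addr0.
- have x0 : (s n == 0%N) = false by apply: negbTE; rewrite -lt0n bd.1.
  rewrite x0 sle // mulr1n.
  rewrite (_ : (if (0 < n)%N then _ else _) = 0); last first.
    by case: ifP => // n0; rewrite sle ?leq_pred.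
  rewrite (_ : (if (s n < a)%N then _ else _) = 0); last first.
    case: ifP => // ax; case: ifP => // bn; rewrite word_series_out //.
    by have := slope_shift slope bn; lia.
  by rewrite mulr0 !addr0.
Qed.

Section Evaluation.
Variables (R : comNzRingType) (h : {rmorphism {fps rat} -> R}) (T Y : R).
Hypothesis TY1 : T + Y + h fps_X * T ^+ a * Y ^+ b = 1.

(** Shifting the index changes the sum only at its top end, by multiples of [Y ^+ N]. *)
Lemma sum_shift (g : nat -> R) m N :
  exists q, \sum_(n < N) (if (m <= n)%N then g (n - m)%N else 0) * Y ^+ n =
    Y ^+ m * \sum_(n < N) g n * Y ^+ n + Y ^+ N * q.
Proof.
have [Nm|/ltnW mN] := leqP N m.
  exists (- (Y ^+ (m - N) * \sum_(n < N) g n * Y ^+ n)).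
  rewrite mulrN mulrA -exprD subnKC // subrr big1 // => i _.
  by rewrite leqNgt (leq_trans (ltn_ord i) Nm) mul0r.
move: (N - m)%N (subnKC mN) => M <-.
exists (- \sum_(j < m) g (M + j)%N * Y ^+ j).
have -> : \sum_(n < m + M) g n * Y ^+ n = \sum_(n < M + m) g n * Y ^+ n.
  by rewrite -!(big_mkord xpredT (fun n => g n * Y ^+ n)) addnC.
rewrite !big_split_ord /= big1 ?add0r => [|i _]; last first.
  by rewrite leqNgt ltn_ord mul0r.
rewrite mulrDr mulrN -addrA [X in _ = _ + X](_ : _ = 0) ?addr0.
  rewrite mulr_sumr; apply: eq_bigr => i _.
  by rewrite leq_addr addKn exprD mulrCA.
apply/eqP; rewrite subr_eq0 !mulr_sumr; apply/eqP/eq_bigr => i _.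
by rewrite !exprD; ring.
Qed.

(* The remainder is the weight of the paths that reach height [N]. *)
Lemma SP_sum_mod N :
  exists q, \sum_(n < N) h (SP a b s n) * T ^+ s n * Y ^+ n = 1 + Y ^+ N * q.
Proof.
(* [w n] is the weight of row [n], with a factor [T] for each unit of abscissa; [wE] is
   [row_poly_rec] evaluated at [T]. *)
pose w n := (map_poly h (row_poly n)).[T].
have wE n : (1 - T) * w n = (n == 0%N)%:R + (if (1 <= n)%N then w (n - 1)%N else 0)
    + h fps_X * T ^+ a * (if (b <= n)%N then w (n - b)%N else 0)
    - h (SP a b s n) * T ^+ s n.
  have := congr1 (fun p => (map_poly h p).[T]) (row_poly_rec n).
  have ifw (c : bool) m :
      (map_poly h (if c then row_poly m else 0)).[T] = if c then w m else 0.
    by case: c; rewrite // rmorph0 horner0.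
  rewrite !(rmorphB, rmorphD, rmorphM, rmorph1, rmorphXn) /= !map_polyC !map_polyX.
  by rewrite !hornerE /= !ifw rmorph_nat subn1.
have [q1 e1] := sum_shift w 1 N; have [q2 e2] := sum_shift w b N.
(* For [N = 0] the sum is empty, and the remainder [-1] makes the right side vanish. *)
exists (if N is N'.+1 then q1 + h fps_X * T ^+ a * q2 else -1).
case: N => [|N] in e1 e2 *; first by rewrite big_ord0 mul1r subrr.
set S := \sum_(n < _) _; set F := \sum_(n < N.+1) w n * Y ^+ n in e1 e2.
have d1 : \sum_(n < N.+1) (nat_of_ord n == 0%N)%:R * Y ^+ n = 1.
  by rewrite big_ord_recl mul1r big1 ?addr0 // => i _; rewrite mul0r.
have eS : (1 - T) * F = 1 + (Y * F + Y ^+ N.+1 * q1)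
    + h fps_X * T ^+ a * (Y ^+ b * F + Y ^+ N.+1 * q2) - S.
  rewrite expr1 in e1; rewrite -e1 -e2 -[X in _ = X + _ + _ - _]d1 /F /S.
  rewrite !mulr_sumr -!big_split -sumrB.
  by apply: eq_bigr => n _ /=; rewrite [LHS]mulrA wE mulrBl !mulrDl !mulrA.
(* By [TY1] an interior point passes on exactly its own weight, so the interior total [F]
   cancels. *)
have eT : 1 - T = Y + h fps_X * T ^+ a * Y ^+ b by rewrite -TY1; ring.
transitivity (1 + (Y * F + Y ^+ N.+1 * q1)
    + h fps_X * T ^+ a * (Y ^+ b * F + Y ^+ N.+1 * q2) - (1 - T) * F).
  by rewrite eS; ring.
by rewrite eT; ring.
Qed.

End Evaluation.
End WordSeries.

(** * Closure properties of algebraic series *)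

Section AlgebraicClosure.
Variables (F E : fieldType) (h : {rmorphism F -> E}).
Local Notation alg := (algebraicOver h).

Lemma algebraic_sum I (r : seq I) (P : pred I) (f : I -> E) :
  (forall i, P i -> alg (f i)) -> alg (\sum_(i <- r | P i) f i).
Proof.
by move=> af; apply: (big_ind alg) => //; [exact: algebraic0 | exact: algebraic_add].
Qed.

Lemma algebraic_prod I (r : seq I) (P : pred I) (f : I -> E) :
  (forall i, P i -> alg (f i)) -> alg (\prod_(i <- r | P i) f i).
Proof.
by move=> af; apply: (big_ind alg) => //; [exact: algebraic1 | exact: algebraic_mul].
Qed.

Lemma algebraic_exp x n : alg x -> alg (x ^+ n).
Proof.
by move=> ax; elim: n => [|n IH]; rewrite ?exprS; [exact: algebraic1 | exact: algebraic_mul].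
Qed.

Lemma algebraic_sign n : alg ((-1) ^+ n).
Proof. exact/algebraic_exp/algebraic_opp/algebraic1. Qed.

Lemma algebraic_det n (A : 'M[E]_n) : (forall i j, alg (A i j)) -> alg (\det A).
Proof.
move=> aA; apply: algebraic_sum => p _; apply: algebraic_mul; first exact: algebraic_sign.
exact: algebraic_prod.
Qed.

(** Cramer's rule: the solution is a quotient of expressions in determinants with algebraic
    entries. *)
Lemma algebraic_solution n (A : 'M[E]_n) (x c : 'cV[E]_n) :
  (forall i j, alg (A i j)) -> (forall i, alg (c i 0)) -> \det A != 0 ->
  A *m x = c -> forall j, alg (x j 0).
Proof.
move=> aA ac dA Axc j.
have -> : x j 0 = (\det A)^-1 * (\adj A *m c) j 0.
  by rewrite -Axc mulmxA mul_adj_mx mul_scalar_mx [(_ *: x) j 0]mxE mulKf.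
apply: algebraic_mul; first exact/algebraic_inv/algebraic_det.
rewrite mxE; apply: algebraic_sum => i _; apply: algebraic_mul => //.
rewrite mxE; apply: algebraic_mul; first exact: algebraic_sign.
by apply: algebraic_det => i' j'; rewrite !mxE.
Qed.

(** Over a field algebraic means integral, and integrality is transitive. *)
Lemma algebraic_root (p : {poly E}) x :
  p != 0 -> root p x -> (forall i, alg p`_i) -> alg x.
Proof.
move=> p0 px ap; apply/integral_algebraic/(integral_root p0 px)/integral_poly => i.
exact/integral_algebraic.
Qed.

Lemma algebraic_nth_root x k : (0 < k)%N -> alg (x ^+ k) -> alg x.
Proof.
move=> k0 ax; apply: (@algebraic_root ('X^k - (x ^+ k)%:P)).
- by rewrite -size_poly_eq0 size_XnsubC.
- by rewrite rootE !hornerE subrr.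
- move=> i; rewrite coefB coefXn coefC; apply: algebraic_sub.
    exact/integral_algebraic/integral_nat.
  by case: ifP => // _; apply: algebraic0.
Qed.

Lemma algebraic_trinomial_root x u v k m n : (0 < k)%N -> alg u -> alg v ->
  x ^+ k = 1 + u * x ^+ (m + k) + v * x ^+ (n + k) -> alg x.
Proof.
move=> k0 au av xk.
apply: (@algebraic_root (1 + u *: 'X^(m + k) + v *: 'X^(n + k) - 'X^k)).
(* The polynomial takes the value 1 at 0, whatever [u] and [v] are. *)
- apply/eqP => /(congr1 (horner^~ 0)).
  rewrite !hornerE !expr0n !addn_eq0 [(k == 0)%N]eqn0Ngt k0 !andbF.
  by rewrite !mulr0 !addr0 subr0 => /eqP; rewrite oner_eq0.
- by rewrite rootE !hornerE xk subrr.
- have an j : alg j%:R by exact/integral_algebraic/integral_nat.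
  move=> i; rewrite !(coefD, coefN, coefZ, coef1, coefXn).
  do ![exact: an | exact: au | exact: av | apply: algebraic_add
      | apply: algebraic_opp | apply: algebraic_mul].
Qed.

End AlgebraicClosure.

(** Cramer's rule for a system over a domain whose row [i] carries a common factor [y i], divided
    out in the fraction field. *)
Lemma algebraic_tofrac_solution (F : fieldType) (S : idomainType)
    (h : {rmorphism F -> {fraction S}}) n (A : 'M[S]_n) (x y c : 'I_n -> S) :
  (forall i j, algebraicOver h (A i j)%:F) -> (forall i, algebraicOver h (y i)%:F) ->
  (forall i, algebraicOver h (c i)%:F) -> (forall i, y i != 0) -> \det A != 0 ->
  (forall i, \sum_j A i j * x j * y i = c i) ->
  forall j, algebraicOver h (x j)%:F.
Proof.
move=> aA ay ac y0 dA Axc j.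
have := @algebraic_solution _ _ h n (map_mx (@FracField.tofrac S) A)
  (\col_j (x j)%:F) (\col_i ((c i)%:F / (y i)%:F)) _ _ _ _ j.
rewrite mxE; apply.
- by move=> i i'; rewrite mxE.
- by move=> i; rewrite mxE; apply: algebraic_div.
- by rewrite det_map_mx tofrac_eq0.
- apply/matrixP => i i'; rewrite !mxE -Axc rmorph_sum mulr_suml; apply: eq_bigr => m _.
  by rewrite !mxE /= !tofracM mulfK // tofrac_eq0.
Qed.

(** * Transport of algebraicity along injective morphisms *)

Section FracExt.
Variables (R S : idomainType) (f : {rmorphism R -> S}).

Lemma frac_ext_tofrac : injective f -> forall x, frac_ext f x%:F = (f x)%:F.
Proof.
move=> fI x; have := @frac_extE _ _ f fI x 1 (oner_neq0 _).
by rewrite !rmorph1 !divr1.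
Qed.

Definition frac_ext_morph (fI : injective f) : {rmorphism {fraction R} -> {fraction S}} :=
  HB.pack (frac_ext f)
    (GRing.isZmodMorphism.Build _ _ (frac_ext f) (frac_ext_is_zmod_morphism fI))
    (GRing.isMonoidMorphism.Build _ _ (frac_ext f) (frac_ext_is_monoid_morphism fI)).

End FracExt.

(** A field morphism preserves and reflects roots, so algebraicity may be tested after an embedding
    into a larger domain. *)
Lemma algebraic_fps_morph (S : idomainType) (f : {rmorphism {fps {fps rat}} -> S})
    (fI : injective f) F :
  algebraicOver (frac_ext_morph fI \o ratfun_fps) (f F)%:F <-> algebraic_fps F.
Proof.
have e p : root (map_poly (frac_ext_morph fI \o ratfun_fps) p) (f F)%:F
         = root (map_poly ratfun_fps p) F%:F.
  rewrite map_poly_comp -(fmorph_root (frac_ext_morph fI)) /=.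
  by rewrite (frac_ext_tofrac fI).
by split=> -[p p0 rp]; exists p; rewrite // ?e // -e.
Qed.

Lemma algebraic_poly_fps p : algebraic_fps (poly_fps p).
Proof.
rewrite /algebraic_fps -(frac_ext_tofrac poly_fps_inj); exact: algebraic_id.
Qed.

Lemma poly_fpsX : poly_fps 'X = fps_X.
Proof.
apply/fpsP => n; apply/fpsP => d /=; rewrite coefX.
by case: eqP; rewrite ?coef1 ?coef0.
Qed.

Lemma poly_fpsCX : poly_fps 'X%:P = fps_const fps_X.
Proof.
apply/fpsP => n; apply/fpsP => d /=; rewrite coefC.
by case: n => [|n] /=; rewrite ?coefX ?coef0.
Qed.

Lemma algebraic_fps_X : algebraic_fps fps_X.
Proof. by rewrite -poly_fpsX; apply: algebraic_poly_fps. Qed.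

Lemma algebraic_fps_nat n : algebraic_fps n%:R.
Proof. by rewrite -(rmorph_nat poly_fps); apply: algebraic_poly_fps. Qed.

Lemma algebraic_fps_add F G :
  algebraic_fps F -> algebraic_fps G -> algebraic_fps (F + G).
Proof. by rewrite /algebraic_fps rmorphD; apply: algebraic_add. Qed.

Lemma algebraic_fps_sub F G :
  algebraic_fps F -> algebraic_fps G -> algebraic_fps (F - G).
Proof. by rewrite /algebraic_fps rmorphB; apply: algebraic_sub. Qed.

Lemma algebraic_fps_mul F G :
  algebraic_fps F -> algebraic_fps G -> algebraic_fps (F * G).
Proof. by rewrite /algebraic_fps rmorphM; apply: algebraic_mul. Qed.

Lemma algebraic_fps_exp F n : algebraic_fps F -> algebraic_fps (F ^+ n).
Proof. by rewrite /algebraic_fps rmorphXn; apply: algebraic_exp. Qed.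

Lemma algebraic_fps_sum I (r : seq I) (P : pred I) (f : I -> {fps {fps rat}}) :
  (forall i, P i -> algebraic_fps (f i)) -> algebraic_fps (\sum_(i <- r | P i) f i).
Proof. by move=> af; rewrite /algebraic_fps rmorph_sum; apply: algebraic_sum. Qed.

Lemma algebraic_fps_divl F G :
  F != 0 -> algebraic_fps F -> algebraic_fps (F * G) -> algebraic_fps G.
Proof.
move=> F0 aF; rewrite /algebraic_fps rmorphM => /algebraic_div/(_ aF).
by rewrite mulrAC divff ?mul1r // tofrac_eq0.
Qed.

Lemma poly_fps_spread k p : (0 < k)%N ->
  poly_fps (p \Po 'X^k) = fps_spread k (poly_fps p).
Proof.
move=> k0; apply/fpsP => n; apply/fpsP => d /=.
by rewrite coef_comp_poly_Xn //; case: ifP; rewrite ?coef0.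
Qed.

(** Substituting [z^k] for [z] in the coefficients of an annihilating polynomial of [F] keeps them
    rational and annihilates the new series. *)
Lemma algebraic_fps_spread k F : (0 < k)%N ->
  algebraic_fps F -> algebraic_fps (fps_spread k F).
Proof.
move=> k0; have sI := @fps_spread_inj {fps rat} k k0.
have cI : injective (comp_poly ('X^k : {poly {poly rat}})).
  by move=> p q /(congr1 poly_fps); rewrite !poly_fps_spread // => /sI/poly_fps_inj.
move/(algebraic_fps_morph sI) => [p p0 rp].
exists (map_poly (frac_ext_morph cI) p); first by rewrite map_poly_eq0.
rewrite -map_poly_comp (eq_map_poly (g := frac_ext_morph sI \o ratfun_fps)) //.
(* The substitutions in rational functions and in series agree, as is checked on numerator and
   denominator. *)
move=> x /=; rewrite (frac_repr x); have := denom_ratioP (repr x).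
move: (\n_(repr x)) (\d_(repr x)) => n d d0.
have fd0 : poly_fps d != 0 by rewrite raddf_eq0 //; apply: poly_fps_inj.
have cd0 : d \Po 'X^k != 0.
  by rewrite -(inj_eq poly_fps_inj) poly_fps_spread // rmorph0 (raddf_eq0 _ sI).
transitivity (ratfun_fps ((n \Po 'X^k)%:F / (d \Po 'X^k)%:F)).
  by congr ratfun_fps; apply: (frac_extE cI).
rewrite [LHS](frac_extE poly_fps_inj) //= !poly_fps_spread //; symmetry.
transitivity (frac_ext_morph sI ((poly_fps n)%:F / (poly_fps d)%:F)).
  by congr (frac_ext_morph sI _); apply: (frac_extE poly_fps_inj).
exact: (frac_extE sI).
Qed.

(** Induction on the height, then on the abscissa, along [word_series_rec]. *)
Lemma algebraic_word_series a b s x n : boundary s -> slope_condition a b s ->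
  algebraic_fps (fps_const (word_series a b s x n)).
Proof.
move=> bd sl; have aX := algebraic_poly_fps 'X%:P; rewrite poly_fpsCX in aX.
have a0 : algebraic_fps 0 := algebraic_fps_nat 0.
have aif (c : bool) f : (c -> algebraic_fps (fps_const f)) ->
    algebraic_fps (fps_const (if c then f else 0)).
  by case: c => [/(_ isT)//|_]; rewrite rmorph0.
elim/ltn_ind: n x => n IHn; elim/ltn_ind => x IHx.
have [sx|xs] := leqP (s n) x; first by rewrite word_series_out ?rmorph0.
have := word_series_rec a b bd xs; move=> /(congr1 (@fps_const _)).
rewrite !(rmorphD, rmorphM) rmorph_nat => e.
set A := (X in _ = X + _) in e.
have aA : algebraic_fps A.
  rewrite /A; apply: algebraic_fps_add; [apply: algebraic_fps_add|].
  - exact: algebraic_fps_nat.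
  - by apply: aif => x0; apply: IHx; rewrite prednK.
  - by apply: aif => n0; apply: IHn; rewrite prednK.
(* For [b > 0] a diagonal step comes from a lower row. For [b = 0] it is a null step, and the
   recursion becomes [(1 - sigma) W = A] for the series [W] itself. *)
have [b0|b0] := eqVneq b 0%N; last first.
  rewrite e; apply: (algebraic_fps_add aA); apply: (algebraic_fps_mul aX).
  apply: aif => /andP[_ bn]; apply: IHn.
  by rewrite ltn_subrL lt0n b0 (leq_trans _ bn) // lt0n.
have a0' : a = 0%N by move: sl; rewrite /slope_condition b0.
have e' : fps_const (word_series a b s x n)
    = A + fps_const fps_X * fps_const (word_series a b s x n).
  have xa : (x - a)%N = x by rewrite a0' subn0.
  have nb : (n - b)%N = n by rewrite b0 subn0.
  have cab : (a <= x)%N && (b <= n)%N by rewrite a0' b0.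
  by rewrite xa nb cab in e.
apply: (@algebraic_fps_divl (1 - fps_const fps_X)).
- apply/eqP => /(congr1 (fun f => fps_coef (fps_coef f 0) 0)) /= /eqP.
  by rewrite subr0 oner_eq0.
- exact: (algebraic_fps_sub (algebraic_fps_nat 1) aX).
- by rewrite mulrBl mul1r {1}e' addrK.
Qed.

(** * Uniformization *)

Section Uniformization.
Variables (a b k l e : nat).
Hypotheses (k0 : (0 < k)%N) (lbka : (l * b = k * a + e)%N) (be : b = 0%N -> e = 0%N).

Notation S := {fps {fps algC}}.

Definition sigma : S := fps_const fps_X.

(* Hensel lifting from [1], first in the variable sigma and then in [u]; the first
   step is needed only for [b = 0]. *)
Lemma uniformizer_exists : exists2 G : S,
  G ^+ k = 1 + fps_X * G ^+ (l + k) + sigma * fps_X ^+ b * G ^+ (e + k) &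
  fps_coef0 (fps_coef0 G) = 1.
Proof.
have kC : (k%:R : algC) != 0 by rewrite pnatr_eq0 -lt0n.
(* [c] is the value of [sigma u^b] at [u = 0]: sigma if [b = 0], and zero otherwise. *)
pose c : {fps algC} := (b == 0%N)%:R * fps_X.
have X0 (A : comNzRingType) : fps_coef0 (fps_X : {fps A}) = 0 by [].
have c0 : fps_coef0 c = 0 by rewrite /c rmorphM /= X0 mulr0.
(* At [u = 0] the equation of [G] reduces to [(1 - c) g^k = 1], because [c] is non-zero only when
   [e = 0]. *)
have [g g_eq g1] : exists2 g : {fps algC}, (1 - c) * g ^+ k = 1 & fps_coef0 g = 1.
  pose p : {poly {fps algC}} := (1 - c)%:P * 'X^k - 1.
  have [||g pg g1] := @hensel _ p 1 k%:R^-1.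
  - rewrite -[LHS]/(fps_coef0 _) /p !hornerE expr1n mulr1.
    by rewrite addrAC subrr add0r rmorphN /= c0 oppr0.
  - rewrite -[fps_coef _ 0]/(fps_coef0 _) /p derivB derivM derivC derivXn -polyC1 derivC.
    rewrite !hornerE hornerMn !hornerE expr1n.
    rewrite subr0 rmorphM rmorphB rmorph1 rmorph_nat /= c0.
    by rewrite subr0 mul1r mulVf.
  exists g; last by rewrite /fps_coef0 g1.
  by apply/eqP; rewrite -subr_eq0 -pg /p !hornerE.
pose p : {poly S} := 'X^k - fps_X *: 'X^(l + k) - (sigma * fps_X ^+ b) *: 'X^(e + k) - 1.
have Xb0 : fps_coef0 (sigma * fps_X ^+ b) = c.
  by rewrite rmorphM rmorphXn /= X0 expr0n /c mulrC.
have pE g' : p.[g'] = g' ^+ k - fps_X * g' ^+ (l + k) - sigma * fps_X ^+ b * g' ^+ (e + k) - 1.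
  by rewrite /p !hornerE.
have dE g' : p^`().[g'] = g' ^+ k.-1 *+ k - fps_X * (g' ^+ (l + k).-1 *+ (l + k))
    - sigma * fps_X ^+ b * (g' ^+ (e + k).-1 *+ (e + k)).
  by rewrite /p -polyC1 !(derivB, derivZ, derivXn, derivC) !hornerE !hornerMn !hornerE subr0.
have gC : fps_coef0 (fps_const g) = g by [].
have cg n : c * g ^+ (e + n) = c * g ^+ n.
  rewrite /c; have [/be -> //|_] := eqVneq b 0%N; by rewrite !mul0r.
have cge : c *+ (e + k) = c *+ k.
  rewrite /c; have [/be -> //|_] := eqVneq b 0%N; by rewrite !mul0r !mul0rn.
have kk : (e + k).-1 = (e + k.-1)%N by rewrite -{1}(prednK k0) addnS.
have Xb0' : fps_coef0 sigma * 0 ^+ b = c by rewrite -Xb0 rmorphM rmorphXn /= X0.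
(* At [u = 0] the derivative is [k g^(k-1) (1 - c)], with inverse [g / k] by the equation of [g]. *)
have [||G pG G1] := @hensel _ p (fps_const g) (g * fps_const k%:R^-1).
- rewrite -[LHS]/(fps_coef0 _) pE !(rmorphB, rmorphM, rmorphXn) rmorph1 /=.
  rewrite X0 gC Xb0' mul0r subr0 cg -{1}[g ^+ k]mul1r -mulrBl g_eq.
  exact: subrr.
- rewrite -[fps_coef _ 0]/(fps_coef0 _) dE !(rmorphB, rmorphM, rmorphMn, rmorphXn) /=.
  rewrite X0 gC Xb0' mul0r subr0 kk mulrnAr cg -mulrnAl cge.
  have kV : fps_const k%:R^-1 * k%:R = 1 :> {fps algC}.
    by rewrite -(rmorph_nat (@fps_const _)) -rmorphM mulVf // rmorph1.
  have gk : g ^+ k = g * g ^+ k.-1 by rewrite -exprS prednK.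
  move: (fps_const _) kV => v kV.
  rewrite -[g ^+ k.-1 *+ k]mulr_natr -[c *+ k]mulr_natr -[RHS]g_eq gk.
  transitivity (v * k%:R * ((1 - c) * (g * g ^+ k.-1))); last by rewrite kV mul1r.
  by move: (k%:R : {fps algC}) => K; ring.
- exists G; last by rewrite -g1 -[fps_coef0 G]/(fps_coef G 0) G1.
  by apply/eqP; rewrite -subr_eq0 -pG pE; apply/eqP; ring.
Qed.

Variable G : S.
Hypothesis G_eq :
  G ^+ k = 1 + fps_X * G ^+ (l + k) + sigma * fps_X ^+ b * G ^+ (e + k).
Hypothesis G1 : fps_coef0 (fps_coef0 G) = 1.

(* [uH] is the inverse of [G], written without [^-1] by means of [G_eq]. *)
Definition uH : S := G ^+ k.-1 * (1 - fps_X * G ^+ l - sigma * fps_X ^+ b * G ^+ e).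
Definition uT : S := uH ^+ k.
Definition uY : S := fps_X * G ^+ l.

Lemma uniformizer_factor :
  G ^+ k * (1 - fps_X * G ^+ l - sigma * fps_X ^+ b * G ^+ e) = 1.
Proof.
transitivity (G ^+ k - fps_X * G ^+ (l + k) - sigma * fps_X ^+ b * G ^+ (e + k)).
  by rewrite !exprD; ring.
by rewrite G_eq; ring.
Qed.

Lemma uHG : uH * G = 1.
Proof. by rewrite /uH mulrAC -exprSr prednK // uniformizer_factor. Qed.

(** From [l b = k a + e] one gets [T^a Y^b = u^b G^e]; the relation is then the equation of [G]
    divided by [G^k]. *)
Lemma uT_uY : uT + uY + sigma * uT ^+ a * uY ^+ b = 1.
Proof.
have TG : uT * G ^+ k = 1 by rewrite /uT -exprMn uHG expr1n.
have -> : sigma * uT ^+ a * uY ^+ b = sigma * fps_X ^+ b * G ^+ e.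
  rewrite /uT /uY [(_ * G ^+ l) ^+ b]exprMn -!exprM lbka exprD.
  transitivity (sigma * fps_X ^+ b * G ^+ e * ((uH * G) ^+ (k * a))).
    by rewrite [(uH * G) ^+ _]exprMn; ring.
  by rewrite uHG expr1n mulr1.
have -> : uT = 1 - fps_X * G ^+ l - sigma * fps_X ^+ b * G ^+ e.
  have := uniformizer_factor; set D := _ - _ => fac.
  by rewrite -[LHS]mulr1 -fac mulrA TG mul1r.
by rewrite /uY; ring.
Qed.

Lemma uTl_uYk : uT ^+ l * uY ^+ k = fps_X ^+ k.
Proof.
rewrite /uT /uY [(_ * G ^+ l) ^+ k]exprMn -!exprM [(l * k)%N]mulnC mulrCA -exprMn uHG.
by rewrite expr1n mulr1.
Qed.

Lemma uH_const : fps_coef0 (fps_coef0 uH) = 1.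
Proof.
have := congr1 (fun x => fps_coef0 (fps_coef0 x)) uHG.
by rewrite !rmorphM !rmorph1 /= G1 mulr1.
Qed.

(** The substitution of [u^k] for [z], with scalars extended to [algC], which contains the [k]-th
    roots of unity. *)
Definition spread_embed : {rmorphism {fps {fps rat}} -> S} :=
  fps_map (fps_map (@ratr algC)) \o fps_spread k.
Local Notation psi := spread_embed.

Lemma spread_embed_inj : injective psi.
Proof.
apply: inj_comp; last exact: fps_spread_inj.
exact/fps_map_inj/fps_map_inj/fmorph_inj.
Qed.

Lemma spread_embedX : psi fps_X = fps_X ^+ k.
Proof. by rewrite /= fps_spreadX // rmorphXn /= fps_mapX. Qed.

Lemma spread_embed_sigma : psi (fps_const fps_X) = sigma.
Proof. by rewrite /= fps_spreadC fps_mapC /= fps_mapX. Qed.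

Lemma scale_spread_embed (c : algC) f : c ^+ k = 1 ->
  fps_scale (fps_const c) (psi f) = psi f.
Proof.
move=> ck; rewrite /= fps_map_spread fps_scale_spread //.
by rewrite -rmorphXn ck rmorph1.
Qed.

End Uniformization.

(** * The linear system of the sections *)

Section PeriodicPart.
Variables (a b k l r : nat) (s t : nat -> nat).
Hypotheses (bd : boundary s) (sl : slope_condition a b s) (k0 : (0 < k)%N).
Hypothesis sE : forall q j, (j < k)%N -> s (q * k + j + r) = (t j + q * l)%N.

(** A climb of [k b] rows is both [k] shifts by [b], each adding at least [a], and [b] periods, each
    adding [l]. Hence the subtraction that defines [e] is exact. *)
Lemma slope_period : (k * a <= l * b)%N.
Proof.
have [b0|b0] := posnP b.
  by move: sl; rewrite /slope_condition b0 /= => ->; rewrite muln0.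
have mono i : (s r + i * a <= s (r + i * b))%N.
  elim: i => [|i IH]; first by rewrite !addn0.
  have := @slope_shift a b s sl (r + i.+1 * b) _.
  rewrite mulSn addnCA leq_addr addKn => /(_ isT); lia.
have := sE b k0; have := sE 0 k0; have := mono k.
rewrite !addn0 !add0n [(r + _)%N]addnC [(b * k)%N]mulnC; lia.
Qed.

Let e := (l * b - k * a)%N.

Lemma period_excess : (l * b = k * a + e)%N.
Proof. by rewrite subnKC // slope_period. Qed.

Lemma period_excess0 : b = 0%N -> e = 0%N.
Proof. by rewrite /e => ->; rewrite muln0. Qed.

Local Notation S := {fps {fps algC}}.
Local Notation psi := (spread_embed k).

Variable G : S.
Hypothesis G_eq :
  G ^+ k = 1 + fps_X * G ^+ (l + k) + sigma * fps_X ^+ b * G ^+ (e + k).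
Hypothesis G1 : fps_coef0 (fps_coef0 G) = 1.

Local Notation T := (uT b k l e G).
Local Notation Y := (uY l G).

(** Unlike the section series of the theorem, which begins at [q = r], this one begins at
    [q = 0]. *)
Definition section_series j : {fps {fps rat}} :=
  FPS (fun q => SP a b s (q * k + j + r)).

Definition SP_embed : {rmorphism {fps rat} -> S} := psi \o @fps_const {fps rat}.

(** Modulo [u^(m+1)] the first [m + 1] periods suffice, and [SP_sum_mod] applies to them;
    [T^l Y^k = u^k] turns a shift by one period into a factor [u^k]. *)
Lemma section_identity :
  \sum_(n < r) SP_embed (SP a b s n) * T ^+ s n * Y ^+ n
  + \sum_(j < k) T ^+ t j * Y ^+ (j + r) * psi (section_series j) = 1.
Proof.
apply/fpsP => m.
have [tt ttE] := choice (fun j => fps_split (section_series j) m.+1).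
have TY1 : T + Y + SP_embed fps_X * T ^+ a * Y ^+ b = 1.
  rewrite [SP_embed _](spread_embed_sigma k).
  exact: (uT_uY k0 period_excess G_eq).
(* Since [u] divides [Y], the remainder for [r + (m+1) k] rows vanishes below order [m + 1]. *)
have [q0 q0E] := SP_sum_mod bd sl TY1 (r + m.+1 * k).
have blockE (q j : nat) : (j < k)%N ->
    T ^+ t j * Y ^+ (j + r) * (SP_embed (SP a b s (q * k + j + r)) * (fps_X ^+ k) ^+ q)
    = SP_embed (SP a b s (q * k + j + r)) * T ^+ s (q * k + j + r) * Y ^+ (q * k + j + r).
  move=> jk; rewrite sE // -(uTl_uYk k0 G_eq); move: T Y (SP_embed _) => T' Y' c.
  by rewrite exprMn -!exprM -addnA !exprD [(k * q)%N]mulnC [(l * q)%N]mulnC; ring.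
have kM : (k * m.+1 = m.+1 + (k * m.+1 - m.+1))%N by rewrite subnKC // leq_pmull.
have psiE j : psi (section_series j) =
    \sum_(q < m.+1) SP_embed (SP a b s (q * k + j + r)) * (fps_X ^+ k) ^+ q
    + fps_X ^+ m.+1 * (fps_X ^+ (k * m.+1 - m.+1) * psi (tt j)).
  rewrite {1}(ttE j) rmorphD rmorph_sum mulrA -exprD -kM rmorphM rmorphXn exprM.
  rewrite spread_embedX //; congr (_ + _); apply: eq_bigr => q _.
  by rewrite rmorphM rmorphXn spread_embedX.
have NE : (r + m.+1 * k = m.+1 + (r + (k * m.+1 - m.+1)))%N by rewrite mulnC; lia.
set lhs := (X in fps_coef X m).
have [w ->] : exists w, lhs = 1 + fps_X ^+ m.+1 * w.
  (* The error has two sources: the remainder of [SP_sum_mod] and the tails of the section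
     series. *)
  exists (fps_X ^+ (r + (k * m.+1 - m.+1)) * G ^+ (l * (r + m.+1 * k)) * q0 +
     \sum_(j < k) T ^+ t j * Y ^+ (j + r) * (fps_X ^+ (k * m.+1 - m.+1) * psi (tt j))).
  rewrite mulrDr !mulrA -exprD -NE -[fps_X ^+ _ * G ^+ _]/(_) exprM -exprMn.
  rewrite addrA -q0E big_split_ord /= /lhs -addrA; congr (_ + _).
  rewrite (sum_blocks (fun i => SP_embed (SP a b s (r + i)) * T ^+ s (r + i) * Y ^+ (r + i))).
  rewrite exchange_big mulr_sumr -big_split; apply: eq_bigr => j _.
  rewrite psiE mulrDr; congr (_ + _); last by ring.
  by rewrite mulr_sumr; apply: eq_bigr => q _; rewrite blockE // ![(r + _)%N]addnC.
rewrite -[LHS]/(fps_coef 1 m + fps_coef (_ * _) m).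
by rewrite fps_coefXnM ltnSn addr0.
Qed.

Let psiI := spread_embed_inj k0.
Local Notation alg := (algebraicOver (frac_ext_morph psiI \o ratfun_fps)).

Lemma alg_psi F : algebraic_fps F -> alg (psi F)%:F.
Proof. by move/(algebraic_fps_morph psiI). Qed.

(** [U] is a [k]-th root of the image of [z], and [g] a root of a trinomial over it. The pair is
    arbitrary so as to cover the conjugates of [u] and [G]. *)
Lemma alg_uniformizer (U g : S) : U ^+ k = psi fps_X ->
  g ^+ k = 1 + U * g ^+ (l + k) + sigma * U ^+ b * g ^+ (e + k) ->
  alg U%:F /\ alg g%:F.
Proof.
move=> Uk gk.
have aU : alg U%:F.
  apply: (@algebraic_nth_root _ _ _ _ k k0); rewrite -tofracXn Uk.
  exact/alg_psi/algebraic_fps_X.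
split; first exact: aU.
have a_sigma : alg sigma%:F.
  rewrite -(spread_embed_sigma k); apply: alg_psi.
  rewrite -poly_fpsCX; exact: algebraic_poly_fps.
apply: (@algebraic_trinomial_root _ _ _ _ U%:F (sigma * U ^+ b)%:F k l e k0).
- exact: aU.
- rewrite tofracM tofracXn.
  by apply: algebraic_mul; [exact: a_sigma | apply: algebraic_exp; exact: aU].
- by rewrite -!tofracXn gk !tofracD tofrac1 !tofracM.
Qed.

Lemma alg_conjugates (tau : {rmorphism S -> S}) :
  (forall f, tau (psi f) = psi f) ->
  [/\ alg (tau fps_X)%:F, alg (tau G)%:F & alg (tau T)%:F].
Proof.
move=> tau_psi.
have tauX : tau fps_X ^+ k = psi fps_X.
  by rewrite -(rmorphXn tau) -(spread_embedX k0); exact: tau_psi.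
have tau_sigma : tau sigma = sigma.
  by rewrite -(spread_embed_sigma k); exact: tau_psi.
have tauG : tau G ^+ k = 1 + tau fps_X * tau G ^+ (l + k)
    + sigma * tau fps_X ^+ b * tau G ^+ (e + k).
  by rewrite -{1}tau_sigma; exact: rmorph_trinomial.
have [aX aG] := alg_uniformizer tauX tauG; split; [exact: aX | exact: aG |].
(* [tau T] is the [k]-th power of the inverse of [tau G]. *)
have tauHG : (tau (uH b k l e G))%:F * (tau G)%:F = 1.
  by rewrite -tofracM -(rmorphM tau) (uHG k0 G_eq) (rmorph1 tau) tofrac1.
have G0 : (tau G)%:F != 0.
  by apply/eqP => G0; move: tauHG; rewrite G0 mulr0 => /eqP; rewrite eq_sym oner_eq0.
rewrite /uT (rmorphXn tau) tofracXn; apply: algebraic_exp.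
by rewrite -[X in alg X](mulfK G0) tauHG; apply: algebraic_div; [exact: algebraic1 | exact: aG].
Qed.

(** Evaluation at [u = sigma = 0]. *)
Definition fps_eval0 : {rmorphism S -> algC} := @fps_coef0 algC \o @fps_coef0 {fps algC}.

(** The conjugation is the substitution of [w u] for [u], which does not change [u^k]. *)
Lemma exists_conjugation (w : algC) : w ^+ k = 1 ->
  exists tau : {rmorphism S -> S},
    [/\ forall f, tau (psi f) = psi f,
        tau fps_X = fps_const (fps_const w) * fps_X &
        forall f, fps_eval0 (tau f) = fps_eval0 f].
Proof.
move=> wk; exists (fps_scale (fps_const w)); split.
- by move=> f; apply: scale_spread_embed.
- exact: fps_scaleX.
- by move=> f; rewrite /= fps_coef0_scale.
Qed.

(** Apply [tau] to [section_identity]. The powers of [u] coming from [Y] go to the unknowns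
    [u^j B_j(u^k)] and to the row factor [(v u)^r], so that the remaining coefficients carry no
    factor [u]. *)
Lemma section_system (tau : {rmorphism S -> S}) (v : S) :
  (forall f, tau (psi f) = psi f) -> tau fps_X = v * fps_X ->
  \sum_(j < k) v ^+ j * tau (T ^+ t j * G ^+ (l * (j + r)))
                * (fps_X ^+ j * psi (section_series j)) * (v * fps_X) ^+ r
  = 1 - \sum_(n < r) SP_embed (SP a b s n) * tau T ^+ s n * tau Y ^+ n.
Proof.
move=> tau_psi tauX; have := congr1 tau section_identity.
rewrite (rmorphD tau) !(rmorph_sum tau) (rmorph1 tau) => <-.
rewrite (eq_bigr (fun n : 'I_r => SP_embed (SP a b s n) * tau T ^+ s n * tau Y ^+ n)).
  rewrite addrAC subrr add0r; apply: eq_bigr => j _.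
  rewrite !(rmorphM tau) tau_psi (rmorphXn tau (j + r)) (rmorphM tau fps_X) tauX.
  rewrite (rmorphXn tau l) (rmorphXn tau (l * _)) exprM.
  by move: (tau _) (tau G ^+ l) (psi _) => c1 c2 c3; rewrite !exprMn !exprD; ring.
move=> n _; have tauSP : tau (SP_embed (SP a b s n)) = SP_embed (SP a b s n).
  exact: (tau_psi (fps_const _)).
move: T Y (SP_embed _) tauSP => T' Y' c tauc.
by rewrite !(rmorphM tau) (rmorphXn tau (s n)) (rmorphXn tau n) tauc.
Qed.

Lemma algebraic_section_series j : (j < k)%N -> algebraic_fps (section_series j).
Proof.
move=> jk; have [w w_prim] := C_prim_root_exists k0.
have wk (i : 'I_k) : (w ^+ i) ^+ k = 1 by rewrite exprAC (prim_expr_order w_prim) expr1n.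
have [tau tauP] := choice (fun i => exists_conjugation (wk i)).
pose V i : S := fps_const (fps_const (w ^+ i)).
pose g j := T ^+ t j * G ^+ (l * (j + r)).
(* Row [i] belongs to the conjugation by [w^i], column [j] to the unknown [u^j B_j(u^k)]. *)
pose A : 'M[S]_k := \matrix_(i, j) (V i ^+ j * tau i (g j)).
have Vk (i : 'I_k) : V i ^+ k = 1.
  by rewrite -(rmorphXn (@fps_const _)) -(rmorphXn (@fps_const _)) wk !rmorph1.
have aV (i : 'I_k) : alg (V i)%:F.
  by apply: (@algebraic_nth_root _ _ _ _ k k0); rewrite -tofracXn Vk; apply: algebraic1.
have conj i : [/\ alg (tau i fps_X)%:F, alg (tau i G)%:F & alg (tau i T)%:F].
  by case: (tauP i) => + _ _; apply: alg_conjugates.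
have aX i : alg (tau i fps_X)%:F by case: (conj i).
have aG i : alg (tau i G)%:F by case: (conj i).
have aT i : alg (tau i T)%:F by case: (conj i).
have X0 : (fps_X : S) != 0.
  apply/eqP => /(congr1 (fun f => fps_coef (fps_coef f 1) 0)) /eqP.
  by rewrite /= oner_eq0.
have V0 (i : 'I_k) : V i != 0.
  apply/eqP => Vi0; move: (Vk i); rewrite Vi0 expr0n gtn_eqF // => /eqP.
  by rewrite eq_sym oner_eq0.
have detA : \det A != 0.
  have epsG : fps_eval0 G = 1 := G1.
  have epsT : fps_eval0 T = 1.
    by rewrite /uT (rmorphXn fps_eval0) [fps_eval0 _](uH_const k0 G_eq G1) expr1n.
  apply/eqP => /(congr1 fps_eval0); rewrite (rmorph0 fps_eval0) -det_map_mx => /eqP.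
  (* [G] and [T] evaluate to 1, so the entry [(i, j)] reduces to [w^(i j)]; the powers of [w] below
     [k] are distinct. *)
  have -> : map_mx fps_eval0 A = (Vandermonde k (\row_(i < k) w ^+ i))^T.
    apply/matrixP => i j'; rewrite !mxE (rmorphM fps_eval0).
    case: (tauP i) => _ _ ->; rewrite /g (rmorphM fps_eval0 (_ ^+ t _)).
    rewrite (rmorphXn fps_eval0 (t _)) (rmorphXn fps_eval0 (l * _)).
    rewrite (rmorphXn fps_eval0 j') [fps_eval0 (V _)]/=.
    by rewrite epsG epsT !expr1n !mulr1.
  rewrite det_tr det_Vandermonde; apply/negP.
  apply/prodf_neq0 => i _; apply/prodf_neq0 => j' ij; rewrite !mxE subr_eq0.
  by rewrite (eq_prim_root_expr w_prim) !modn_small // gtn_eqF.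
have aXB : alg (fps_X ^+ j * psi (section_series j))%:F.
  have := @algebraic_tofrac_solution _ _ (frac_ext_morph psiI \o ratfun_fps) k A
    (fun j => fps_X ^+ j * psi (section_series j)) (fun i => (V i * fps_X) ^+ r)
    (fun i => 1 - \sum_(n < r) SP_embed (SP a b s n) * tau i T ^+ s n * tau i Y ^+ n)
    _ _ _ _ detA _ (Ordinal jk).
  apply=> [i j'|i|i|i|i].
  - rewrite mxE tofracM tofracXn /g (rmorphM (tau i) (_ ^+ t _)).
    rewrite (rmorphXn (tau i) (t _)) (rmorphXn (tau i) (l * _)) tofracM !tofracXn.
    apply: algebraic_mul; first by apply: algebraic_exp; apply: aV.
    by apply: algebraic_mul; apply: algebraic_exp; [apply: aT | apply: aG].
  - rewrite tofracXn; apply: algebraic_exp.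
    by case: (tauP i) => _ <- _; apply: aX.
  - rewrite tofracB tofrac1; apply: algebraic_sub; first exact: algebraic1.
    rewrite (big_morph _ (@tofracD _) (@tofrac0 _)); apply: algebraic_sum => n _.
    rewrite !tofracM !tofracXn.
    apply: algebraic_mul; first apply: algebraic_mul.
    + rewrite (SP_word_series bd sl); apply: alg_psi.
      exact: algebraic_word_series.
    + by apply: algebraic_exp; apply: aT.
    + apply: algebraic_exp; rewrite /uY (rmorphM (tau i)) (rmorphXn (tau i)) tofracM tofracXn.
      by apply: algebraic_mul; [apply: aX | apply: algebraic_exp; apply: aG].
  - by rewrite expf_neq0 // mulf_neq0.
  - case: (tauP i) => tau_psi tauX _; rewrite -(section_system tau_psi tauX).
    by apply: eq_bigr => j' _; rewrite mxE.
(* The system yields [u^j B_j(u^k)]; division by the algebraic [u^j] remains. *)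
have [aX0 _] := alg_uniformizer (esym (spread_embedX k0)) G_eq.
have Xj0 : (fps_X ^+ j : S)%:F != 0 by rewrite tofrac_eq0 expf_neq0.
apply/(algebraic_fps_morph psiI).
have -> : (psi (section_series j))%:F =
    (fps_X ^+ j * psi (section_series j))%:F / (fps_X ^+ j)%:F.
  by rewrite tofracM mulrC mulKf.
by apply: algebraic_div; [exact: aXB | rewrite tofracXn; apply: algebraic_exp; exact: aX0].
Qed.

End PeriodicPart.

(** * From the sections to the generating functions *)

Theorem corollary4p3 (a b : nat) (s : nat -> nat) (k r : nat) :
  boundary s -> ultimately_periodic s k r -> slope_condition a b s ->
  algebraic_fps (SP_gf a b s) /\
  (forall j : nat, (j < k)%N -> algebraic_fps (SP_section_gf a b s k r j)).
Proof.
move=> bd [s1 [s2 [l [[_ k0 _ s2E] s1r sE]]]] sl.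
(* [last 0 s1] is the offset of the periodic part, equal to 0 if the initial segment is empty. *)
pose t j := (last 0 s1 + s2 j)%N.
have stE q j : (j < k)%N -> (s (q * k + j + r) = t j + q * l)%N.
  move=> jk; rewrite sE /concat_boundary s1r ltnNge leq_addl /= addnK s2E.
  by rewrite modnMDl divnMDl // modn_small // divn_small // addn0 addnA.
have [G G_eq G1] := uniformizer_exists l k0 (@period_excess0 a b k l).
have aB := algebraic_section_series bd sl k0 stE G_eq G1.
have aSP n : algebraic_fps (fps_const (SP a b s n)).
  by rewrite (SP_word_series bd sl); apply: algebraic_word_series.
have aX n : algebraic_fps (fps_X ^+ n) by apply/algebraic_fps_exp/algebraic_fps_X.
split=> [|j jk].
  (* Every [n >= r] is [q k + j + r] for unique [q] and [j < k]; the finitely many terms below [r]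
     are algebraic on their own. *)
  suff -> : SP_gf a b s = \sum_(n < r) fps_const (SP a b s n) * fps_X ^+ n
      + \sum_(j < k) fps_X ^+ (j + r) * fps_spread k (section_series a b k r s j).
    apply: algebraic_fps_add; apply: algebraic_fps_sum => i _; apply: algebraic_fps_mul.
    - exact: aSP.
    - exact: aX.
    - exact: aX.
    - exact/(algebraic_fps_spread k0)/aB.
  apply/fpsP => n; rewrite -[RHS]/(fps_coef _ n + fps_coef _ n) !fps_coef_sum.
  have [nr|rn] := ltnP n r.
    rewrite (bigD1 (Ordinal nr)) // [X in _ + X + _]big1 ?[X in _ + X]big1.
    - by rewrite fps_coefCM fps_coefXn eqxx mulr1 !addr0.
    - by move=> i _; rewrite fps_coefXnM (leq_trans nr) ?leq_addl.
    - move=> i; rewrite -val_eqE eq_sym fps_coefCM fps_coefXn => /negPf ->.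
      exact: mulr0.
  rewrite big1 ?add0r => [|i _]; last first.
    by rewrite fps_coefCM fps_coefXn gtn_eqF ?mulr0 // (leq_trans _ rn).
  have mk : ((n - r) %% k < k)%N by rewrite ltn_mod.
  have nE := divn_eq (n - r) k.
  rewrite (bigD1 (Ordinal mk)) // [X in _ = _ + X]big1 => [|i].
    have mle := leq_mod (n - r) k.
    have mn : ((n - r) %% k + r <= n)%N by lia.
    rewrite [RHS]addr0 fps_coefXnM ltnNge mn /=.
    have -> : (n - ((n - r) %% k + r) = (n - r) %/ k * k)%N by lia.
    rewrite dvdn_mull // mulnK //; congr (SP _ _ _ _); lia.
  rewrite -val_eqE fps_coefXnM => /eqP /= ij; case: ltnP => // irn /=.
  case: ifP => // /dvdnP[q qE]; case: ij.
  have -> : (n - r = q * k + i)%N by lia.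
  by rewrite modnMDl modn_small.
(* The two series differ only by the terms with [q < r], each of them algebraic. *)
suff -> : SP_section_gf a b s k r j = section_series a b k r s j
    - \sum_(q < r) fps_const (SP a b s (q * k + j + r)) * fps_X ^+ q.
  apply: algebraic_fps_sub; first exact: aB.
  by apply: algebraic_fps_sum => q _; apply: algebraic_fps_mul; [exact: aSP | exact: aX].
apply/fpsP => q; rewrite -[RHS]/(fps_coef _ q - fps_coef _ q) fps_coef_sum.
rewrite [LHS]/=; have [rq|qr] := leqP r q.
  rewrite big1 ?subr0 // => i _.
  by rewrite fps_coefCM fps_coefXn gtn_eqF ?mulr0 // (leq_trans _ rq).
rewrite (bigD1 (Ordinal qr)) // [X in _ = _ - (_ + X)]big1 => [|i].
  by rewrite fps_coefCM fps_coefXn eqxx mulr1 [X in _ - X]addr0 subrr.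
by rewrite -val_eqE eq_sym fps_coefCM fps_coefXn => /negPf ->; apply: mulr0.
Qed.
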